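(* Let $(M,\omega_\alpha,\mathcal F)$, $\alpha\in\{1,\dots,k\}$, be a $k$-symplectic manifold of dimension $n(k+1)$, let $L=T\mathcal F=L_1\oplus\cdots\oplus L_k$, and let $Q$ be an $n$-dimensional integrable distribution on $M$ with $TM=L\oplus Q$ such that (i) $\omega_\alpha(Y,Y')=0$ for all $Y,Y'\in\Gamma(Q)$ and all $\alpha\in\{1,\dots,k\}$; (ii) $[X,Y]\in\Gamma(L_\alpha\oplus Q)$ for all $X\in\Gamma(L_\alpha)$, $Y\in\Gamma(Q)$ and all $\alpha\in\{1,\dots,k\}$. Assume moreover that $(i_1^\ast)^{-1}(\psi_1^{YY'})=\cdots=(i_k^\ast)^{-1}(\psi_k^{YY'})$ for all $Y,Y'\in\Gamma(Q)$. Then there exists a unique (linear) connection $\nabla$ on $M$ satisfying the following properties: (1) $\nabla$ preserves each $L_\alpha$ and $Q$, i.e. $\nabla_V X\in\Gamma(L_\alpha)$ for all $V\in\Gamma(TM)$, $X\in\Gamma(L_\alpha)$, $\alpha\in\{1,\dots,k\}$, and $\nabla_V Y\in\Gamma(Q)$ for all $V\in\Gamma(TM)$, $Y\in\Gamma(Q)$; (2) $\nabla\omega_1=\cdots=\nabla\omega_k=0$; (3) $T(X,Y)=0$ for all $X\in\Gamma(L)$ and $Y\in\Gamma(Q)$, where $T$ is the torsion tensor field of $\nabla$.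
   Context: All objects are smooth; $\Gamma(E)$ denotes the sections of a bundle $E$. For a $2$-form $\omega$ on $M$ and $x\in M$ put $C_x(\omega)=\{v\in T_xM:\omega_x(v,w)=0 \text{ for all } w\in T_xM\}$. A $k$-symplectic manifold $(M,\omega_\alpha,\mathcal F)$ is a manifold $M$ of dimension $n(k+1)$ with $k$ closed $2$-forms $\omega_1,\dots,\omega_k$ and an $nk$-dimensional foliation $\mathcal F$ such that $C_x(\omega_1)\cap\cdots\cap C_x(\omega_k)=\{0\}$ for all $x$, and $\omega_\alpha(X,X')=0$ for all $X,X'\in\Gamma(T\mathcal F)$ and all $\alpha$. Put $L=T\mathcal F$ and $L_{\alpha,x}=\bigcap_{\beta\neq\alpha}C_x(\omega_\beta)$ (with $L_1=L$ if $k=1$). Known facts: each $L_\alpha$ is an integrable distribution (its foliation is denoted $\mathcal F_\alpha$), $L=L_1\oplus\cdots\oplus L_k$, and $X\mapsto \omega_\alpha(X,\cdot)$ is an isomorphism from $L_\alpha$ onto $(TM/L)^\ast$. Using $TM=L_1\oplus\cdots\oplus L_k\oplus Q$, one identifies $Q\cong TM/L$, $Q^\ast=\mathrm{ann}(L)$ and $L_\alpha^\ast=\mathrm{ann}\big(\bigoplus_{\beta\ne\alpha}L_\beta\oplus Q\big)$. The map $i_\alpha^\ast:Q\to L_\alpha^\ast$, $i_\alpha^\ast(Y)(X)=\omega_\alpha(Y,X)$ for $X\in L_\alpha$, is an isomorphism. For $Y,Y'\in\Gamma(Q)$, $\psi_\alpha^{YY'}$ is the $1$-form $V\mapsto Y(\omega_\alpha(Y',V))-\omega_\alpha(Y',[Y,V])$,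 which, under (i), (ii) and integrability of $Q$, is a section of $L_\alpha^\ast$. *)

(* Defs.v *)
From HB Require Import structures.
From mathcomp Require Import all_boot all_order all_algebra.
From mathcomp Require Import all_classical all_reals all_analysis.
From mathcomp Require Import ring.
Set Implicit Arguments.
Unset Strict Implicit.
Unset Printing Implicit Defensive.
Import Order.TTheory GRing.Theory Num.Theory.
Import numFieldNormedType.Exports.
Local Open Scope classical_set_scope.
Local Open Scope ring_scope.

Section Euclidean.
Context {R : realType} {d : nat}.
Implicit Types (U : set 'rV[R]_d) (f g : 'rV[R]_d -> R).

(* [Ck m U f]: all iterated partial derivatives of [f] of order at most [m]
   exist and are continuous at the points of [U].  Only used for open [U]. *)
Fixpoint Ck (m : nat) U f : Prop :=
  (forall a, U a -> {for a, continuous f}) /\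
  if m is m'.+1 then
    forall j : 'I_d, (forall a, U a -> derivable f a 'e_j) /\
                     Ck m' U (fun a => 'D_'e_j f a)
  else True.

Definition Cinfty U f := forall m, Ck m U f.

Lemma CkS m U f : Ck m.+1 U f -> Ck m U f.
Proof.
elim: m f => [|m IH] f; first by case.
move=> [cf Hf]; split=> // j; have [df D] := Hf j.
by split=> //; exact: IH.
Qed.

Lemma Ck_sub m U V f : V `<=` U -> Ck m U f -> Ck m V f.
Proof.
move=> VU; elim: m f => [|m IH] f [cf Hf]; split=> //; try by move=> a /VU /cf.
move=> j; have [df D] := Hf j; split; first by move=> a /VU /df.
exact: IH.
Qed.

Lemma near_eq_continuous f g a :
  (\forall b \near a, f b = g b) -> {for a, continuous f} -> {for a, continuous g}.
Proof.
move=> fg cf; rewrite /prop_for /continuous_at -(nbhs_singleton fg).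
by apply: cvg_trans cf; apply: near_eq_cvg fg.
Qed.

Lemma Ck_ext m U f g : open U -> (forall a, U a -> f a = g a) ->
  Ck m U f -> Ck m U g.
Proof.
move=> oU; elim: m f g => [|m IH] f g fg [cf Hf].
all: have near_fg a : U a -> \forall b \near a, f b = g b by
  move=> Ua; apply: filterS (open_nbhs_nbhs (conj oU Ua)).
all: have cg a : U a -> {for a, continuous g} by
  move=> Ua; exact: near_eq_continuous (near_fg _ Ua) (cf _ Ua).
  by split.
split=> // j; have [df D] := Hf j; split.
  by move=> a Ua; apply: near_eq_derivable (near_fg _ Ua) (df _ Ua).
by apply: IH D => a Ua; apply: near_eq_derive (near_fg _ Ua).
Qed.

Lemma Ck_cst m U (c : R) : Ck m U (fun=> c).
Proof.
elim: m c => [|m IH] c; split=> //; try by move=> a _; exact: cst_continuous.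
move=> j; split; first by move=> a _; exact: derivable_cst.
rewrite (_ : 'D_'e_j _ = fun=> 0); first exact: IH.
by apply/funext => a; rewrite derive_cst.
Qed.

Lemma CkD m U f g : open U -> Ck m U f -> Ck m U g -> Ck m U (fun a => f a + g a).
Proof.
move=> oU; elim: m f g => [|m IH] f g [cf Hf] [cg Hg]; split=> //;
  try by move=> a Ua; apply: continuousD; [exact: cf | exact: cg].
move=> j; have [df Df] := Hf j; have [dg Dg] := Hg j; split.
  by move=> a Ua; apply: derivableD; [exact: df | exact: dg].
apply: Ck_ext (IH _ _ Df Dg) => // a Ua.
by rewrite [RHS]deriveD; [|exact: df|exact: dg].
Qed.

Lemma CkM m U f g : open U -> Ck m U f -> Ck m U g -> Ck m U (fun a => f a * g a).
Proof.
move=> oU; elim: m f g => [|m IH] f g Hf Hg.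
  by split=> // a Ua; apply: continuousM; [exact: Hf.1 | exact: Hg.1].
have [cf Df] := Hf; have [cg Dg] := Hg.
split; first by move=> a Ua; apply: continuousM; [exact: cf | exact: cg].
move=> j; have [df Dfj] := Df j; have [dg Dgj] := Dg j; split.
  by move=> a Ua; apply: derivableM; [exact: df | exact: dg].
have H := CkD oU (IH _ _ (CkS Hf) Dgj) (IH _ _ (CkS Hg) Dfj).
apply: Ck_ext H => // a Ua.
by rewrite [RHS]deriveM; [|exact: df|exact: dg].
Qed.

End Euclidean.

(* The values of [chart_map] outside [chart_dom], and of [chart_inv] outside
   the image of [chart_dom], are irrelevant. *)
Record chart (R : realType) (d : nat) (M : topologicalType) := Chart {
  chart_dom : set M;
  chart_map : M -> 'rV[R]_d;
  chart_inv : 'rV[R]_d -> M;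
  chart_dom_open : open chart_dom;
  chart_img_open : open (chart_map @` chart_dom);
  chart_mapK : {in chart_dom, cancel chart_map chart_inv};
  chart_map_cont : forall x, chart_dom x -> {for x, continuous chart_map};
  chart_inv_cont : forall a, (chart_map @` chart_dom) a ->
    {for a, continuous chart_inv} }.

Definition coord (R : realType) d (M : topologicalType) (c : chart R d M)
  (j : 'I_d) : M -> R := fun x => chart_map c x 0 j.

Definition smooth_transition (R : realType) d (M : topologicalType)
    (c c' : chart R d M) :=
  forall j : 'I_d, Cinfty (chart_map c @` (chart_dom c `&` chart_dom c'))
                          (coord c' j \o chart_inv c).

Record manifold (R : realType) (d : nat) := Manifold {
  carrier :> topologicalType;
  manifold_hausdorff : hausdorff_space carrier;
  manifold_second_countable : @second_countable carrier;
  atlas : set (chart R d carrier);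
  atlas_cover : forall x, exists2 c, atlas c & chart_dom c x;
  atlas_compat : forall c c', atlas c -> atlas c' -> smooth_transition c c';
  atlas_maximal : forall c,
    (forall c', atlas c' -> smooth_transition c c' /\ smooth_transition c' c) ->
    atlas c }.
Arguments atlas {R d} _ _.

Section SmoothFunctions.
Context {R : realType} {d : nat} {M : manifold R d}.
Implicit Types (x : M) (f g : M -> R).

Definition smooth_on (U : set M) f := forall c, atlas M c ->
  Cinfty (chart_map c @` (U `&` chart_dom c)) (f \o chart_inv c).

Definition smooth_at x f := exists U, [/\ open U, U x & smooth_on U f].

Definition smooth f := smooth_on setT f.

Lemma chart_open_image (c : chart R d M) (U : set M) :
  open U -> open (chart_map c @` (U `&` chart_dom c)).
Proof.
move=> oU; rewrite openE => _ [x [Ux cx] <-].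
have inv_x : chart_inv c (chart_map c x) = x.
  by apply: chart_mapK; rewrite inE.
have img_x : (chart_map c @` chart_dom c) (chart_map c x) by exists x.
have Hinv : nbhs (chart_map c x) (chart_inv c @^-1` U).
  apply: (chart_inv_cont img_x); rewrite inv_x.
  exact: open_nbhs_nbhs.
have Himg := open_nbhs_nbhs (conj (@chart_img_open _ _ _ c) img_x).
apply: filterS (filterI Hinv Himg) => b [/= Ub [y cy yb]].
subst b; by exists y => //; split=> //; move: Ub => /=; rewrite chart_mapK ?inE.
Qed.

Lemma smooth_on_ext (U : set M) f g : open U -> (forall y, U y -> f y = g y) ->
  smooth_on U f -> smooth_on U g.
Proof.
move=> oU fg sf c Ac m; apply: Ck_ext (sf c Ac m); first exact: chart_open_image.
by move=> _ [y [Uy cy] <-] /=; rewrite chart_mapK ?inE//; exact: fg.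
Qed.

Lemma smooth_on_sub (U V : set M) f : V `<=` U -> smooth_on U f -> smooth_on V f.
Proof.
move=> VU sf c Ac m; apply: Ck_sub (sf c Ac m).
by move=> _ [y [/VU Uy cy] <-]; exists y.
Qed.

Lemma smooth_at_near x f : smooth_at x f -> \forall y \near x, smooth_at y f.
Proof.
move=> [U [oU Ux sU]]; apply: filterS (open_nbhs_nbhs (conj oU Ux)) => y Uy.
by exists U.
Qed.

Lemma smooth_at_ext x f g : (\forall y \near x, f y = g y) ->
  smooth_at x f -> smooth_at x g.
Proof.
rewrite /prop_near1 nbhsE => -[V [oV Vx] fg] [U [oU Ux sU]].
exists (U `&` V); split=> //; first exact: openI.
apply: (@smooth_on_ext _ f); first exact: openI.
  by move=> y [_ /fg].
by apply: smooth_on_sub sU => y [].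
Qed.

Lemma smooth_smooth_at f x : smooth f -> smooth_at x f.
Proof. by move=> sf; exists setT; split=> //; exact: openT. Qed.

Lemma smooth_at_cst x (a : R) : smooth_at x (fun=> a).
Proof. by exists setT; split=> // [|c _ m]; [exact: openT|exact: Ck_cst]. Qed.

Lemma smooth_at_op (op : R -> R -> R) x f g :
  (forall m (U : set 'rV[R]_d) F G, open U -> Ck m U F -> Ck m U G ->
     Ck m U (fun a => op (F a) (G a))) ->
  smooth_at x f -> smooth_at x g -> smooth_at x (fun y => op (f y) (g y)).
Proof.
move=> Hop [U [oU Ux sU]] [V [oV Vx sV]].
have oI : open (U `&` V) by exact: openI.
exists (U `&` V); split=> // c Ac m; apply: Hop.
- exact: chart_open_image.
- by apply: (smooth_on_sub _ sU) => // y [].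
- by apply: (smooth_on_sub _ sV) => // y [].
Qed.

Lemma smooth_atD x f g :
  smooth_at x f -> smooth_at x g -> smooth_at x (fun y => f y + g y).
Proof. by apply: smooth_at_op => *; exact: CkD. Qed.

Lemma smooth_atM x f g :
  smooth_at x f -> smooth_at x g -> smooth_at x (fun y => f y * g y).
Proof. by apply: smooth_at_op => *; exact: CkM. Qed.

End SmoothFunctions.

Section Tangent.
Context {R : realType} {d : nat} {M : manifold R d}.

(* Tangent vectors at [x] are the derivations of the algebra of germs at [x] of
   smooth functions.  A germ is represented by any function [M -> R] that is
   smooth near [x]; the value 0 on functions that are not smooth near [x] is a
   normalisation which makes two tangent vectors equal as soon as they agree on
   germs. *)
Definition derivation_at (x : M) (v : (M -> R) -> R^o) : Prop :=
  [/\ forall f, ~ smooth_at x f -> v f = 0,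
      forall f g, smooth_at x f -> smooth_at x g ->
        (\forall y \near x, f y = g y) -> v f = v g,
      forall (a : R) f g, smooth_at x f -> smooth_at x g ->
        v (fun y => a * f y + g y) = a * v f + v g
    & forall f g, smooth_at x f -> smooth_at x g ->
        v (fun y => f y * g y) = f x * v g + g x * v f].

Definition derivation_pred (x : M) : {pred (M -> R) -> R^o} :=
  fun v => `[< derivation_at x v >].

Lemma derivation_submod_closed x : submod_closed (derivation_pred x).
Proof.
split.
  apply/asboolP; split=> //= [a f g _ _|f g _ _].
    by rewrite mulr0 addr0.
  by rewrite !mulr0 addr0.
move=> b v w /asboolP[v0 vE vL vM] /asboolP[w0 wE wL wM].
apply/asboolP; split=> [f nf|f g sf sg fg|a f g sf sg|f g sf sg];
  rewrite !fctE.
- by rewrite v0// w0// scaler0 addr0.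
- by rewrite (vE f g)// (wE f g).
- rewrite vL// wL// /GRing.scale/= !mulrDr !addrA; congr (_ + _).
  by rewrite mulrCA -!addrA; congr (_ + _); rewrite addrC.
- rewrite vM// wM// /GRing.scale/= !mulrDr !addrA; congr (_ + _).
  by rewrite !(mulrCA b) -!addrA; congr (_ + _); rewrite addrC.
Qed.

HB.instance Definition _ (x : M) :=
  GRing.isSubmodClosed.Build R ((M -> R) -> R^o) (derivation_pred x)
    (derivation_submod_closed x).

Record tangent (x : M) := Tangent {
  tangent_fun :> (M -> R) -> R^o;
  tangent_funP : tangent_fun \in derivation_pred x }.

HB.instance Definition _ x := [isSub for @tangent_fun x].
HB.instance Definition _ x := [Choice of tangent x by <:].
HB.instance Definition _ x := [SubChoice_isSubLmodule of tangent x by <:].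

Section TangentTheory.
Variables (x : M) (v : tangent x).
Implicit Types f g : M -> R.

Lemma tangentP : derivation_at x v.
Proof. by apply/asboolP; exact: tangent_funP. Qed.

Lemma tangent_out f : ~ smooth_at x f -> v f = 0.
Proof. by have [+ _ _ _] := tangentP; exact. Qed.

Lemma tangent_near f g : smooth_at x f -> (\forall y \near x, f y = g y) ->
  v f = v g.
Proof.
by move=> sf fg; have [_ + _ _] := tangentP; apply=> //; exact: smooth_at_ext sf.
Qed.

Lemma tangent_lin a f g : smooth_at x f -> smooth_at x g ->
  v (fun y => a * f y + g y) = a * v f + v g.
Proof. by have [_ _ + _] := tangentP; exact. Qed.

Lemma tangent_mul f g : smooth_at x f -> smooth_at x g ->
  v (fun y => f y * g y) = f x * v g + g x * v f.
Proof. by have [_ _ _] := tangentP; exact. Qed.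

Lemma tangent_add f g : smooth_at x f -> smooth_at x g ->
  v (fun y => f y + g y) = v f + v g.
Proof.
move=> sf sg; have := tangent_lin 1 sf sg; rewrite mul1r => <-.
by congr (v _); apply/funext => y; rewrite mul1r.
Qed.

End TangentTheory.

End Tangent.
Arguments tangent {R d} M x.

Section VectorFields.
Context {R : realType} {d : nat} (M : manifold R d).
Implicit Types (x : M) (f g : M -> R).

Definition smooth_section_at x (X : forall y, tangent M y) :=
  forall f, smooth_at x f -> smooth_at x (fun y => X y f).

Record vfield := VField {
  vf_fun :> forall x, tangent M x;
  vf_smooth : forall x, smooth_section_at x vf_fun }.

HB.instance Definition _ := gen_eqMixin vfield.
HB.instance Definition _ := gen_choiceMixin vfield.

Lemma vfieldP (X Y : vfield) : (forall x, X x = Y x) -> X = Y.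
Proof.
case: X Y => [X sX] [Y sY] /= XY.
have {}XY := functional_extensionality_dep XY.
by subst Y; congr VField; exact: Prop_irrelevance.
Qed.

Lemma vf0_smooth x : smooth_section_at x (fun y => 0 : tangent M y).
Proof. by move=> f _; exact: smooth_at_cst. Qed.

Definition vf0 : vfield := VField vf0_smooth.

Lemma vf_add_smooth (X Y : vfield) x : smooth_section_at x (fun y => X y + Y y).
Proof. by move=> f sf; apply: smooth_atD; exact: vf_smooth. Qed.

Definition vf_add X Y : vfield := VField (vf_add_smooth X Y).

Lemma vf_scale_smooth f (sf : smooth f) (X : vfield) x :
  smooth_section_at x (fun y => f y *: X y).
Proof.
move=> g sg; apply: smooth_atM; first exact: smooth_smooth_at.
exact: vf_smooth.
Qed.

Definition vf_scale f (sf : smooth f) X : vfield :=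
  VField (vf_scale_smooth sf X).

Definition bracket_fun (X Y : vfield) x : (M -> R) -> R^o := fun f =>
  if `[< smooth_at x f >] then X x (fun y => Y y f) - Y x (fun y => X y f)
  else 0.

Lemma vf_near (X : vfield) x f g : smooth_at x f -> (\forall y \near x, f y = g y) ->
  \forall y \near x, X y f = X y g.
Proof.
move=> sf fg; have := nbhs_interior fg; move: (smooth_at_near sf).
by apply: filterS2 => y sfy fgy; exact: tangent_near.
Qed.

Lemma bracket_funE X Y x f : smooth_at x f ->
  bracket_fun X Y x f = X x (fun y => Y y f) - Y x (fun y => X y f).
Proof. by rewrite /bracket_fun => sf; case: asboolP. Qed.

Lemma vf_comp_near (X Y : vfield) x f g : smooth_at x f ->
  (\forall y \near x, f y = g y) -> X x (fun y => Y y f) = X x (fun y => Y y g).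
Proof.
by move=> sf fg; apply: tangent_near; [exact: vf_smooth | exact: vf_near].
Qed.

Lemma vf_comp_lin (X Y : vfield) x a f g : smooth_at x f -> smooth_at x g ->
  X x (fun y => Y y (fun z => a * f z + g z)) =
  a * X x (fun y => Y y f) + X x (fun y => Y y g).
Proof.
move=> sf sg; rewrite -tangent_lin; try exact: vf_smooth.
apply: tangent_near.
  by apply: vf_smooth; apply: smooth_atD => //; apply: smooth_atM => //;
     exact: smooth_at_cst.
by apply: filterS2 (smooth_at_near sf) (smooth_at_near sg) => y *;
   exact: tangent_lin.
Qed.

Lemma vf_comp_mul (X Y : vfield) x f g : smooth_at x f -> smooth_at x g ->
  X x (fun y => Y y (fun z => f z * g z)) =
  (f x * X x (fun y => Y y g) + Y x g * X x f) +
  (g x * X x (fun y => Y y f) + Y x f * X x g).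
Proof.
move=> sf sg; have sYf := vf_smooth Y sf; have sYg := vf_smooth Y sg.
rewrite -!tangent_mul// -tangent_add; [|exact: smooth_atM|exact: smooth_atM].
apply: tangent_near; first by apply: vf_smooth; exact: smooth_atM.
by apply: filterS2 (smooth_at_near sf) (smooth_at_near sg) => y *;
   exact: tangent_mul.
Qed.

Lemma bracket_derivation X Y x : bracket_fun X Y x \in derivation_pred x.
Proof.
apply/asboolP; split=> [f nf|f g sf sg fg|a f g sf sg|f g sf sg].
- by rewrite /bracket_fun; case: asboolP.
- by rewrite !bracket_funE// (vf_comp_near X Y sf fg) (vf_comp_near Y X sf fg).
- rewrite !bracket_funE//; last first.
    by apply: smooth_atD => //; apply: smooth_atM => //; exact: smooth_at_cst.
  by rewrite !vf_comp_lin//; ring.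
- rewrite !bracket_funE//; last exact: smooth_atM.
  by rewrite !vf_comp_mul//; ring.
Qed.

Lemma bracket_smooth (X Y : vfield) x :
  smooth_section_at x (fun y => Tangent (bracket_derivation X Y y)).
Proof.
move=> f sf; apply: (@smooth_at_ext _ _ _ _
  (fun y => X y (fun z => Y z f) + (-1) * Y y (fun z => X z f))).
  apply: filterS (smooth_at_near sf) => y sfy /=.
  by rewrite bracket_funE// mulN1r.
apply: smooth_atD; first by do 2 apply: vf_smooth.
by apply: smooth_atM; [exact: smooth_at_cst | do 2 apply: vf_smooth].
Qed.

Definition bracket X Y : vfield := VField (bracket_smooth X Y).

End VectorFields.

Section Distributions.
Context {R : realType} {d : nat} (M : manifold R d).
Implicit Types (x : M) (D E : forall x : M, set (tangent M x)) (r : nat).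

Definition is_basis x (S : set (tangent M x)) r (b : 'I_r -> tangent M x) :=
  (forall a : 'I_r -> R, \sum_i a i *: b i = 0 -> forall i, a i = 0) /\
  S = range (fun a : 'I_r -> R => \sum_i a i *: b i).

Definition distribution r D := forall x,
  exists (U : set M) (X : 'I_r -> forall y, tangent M y),
    [/\ open U, U x,
        forall i y, U y -> smooth_section_at y (X i)
      & forall y, U y -> is_basis (D y) (fun i => X i y)].

(* Around each point there is a chart of the (maximal) atlas in which [D] is
   tangent to the plaques, i.e. the slices on which the coordinates of index
   at least [r] are constant. *)
Definition integrable_distribution r D := distribution r D /\
  forall x, exists c, [/\ atlas M c, chart_dom c x
    & forall y, chart_dom c y ->
        D y = [set v | forall j : 'I_d, (r <= j)%N -> v (coord c j) = 0]].

(* A foliation is represented by its tangent distribution [T F]. *)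
Definition foliation := integrable_distribution.

Definition section_of D (X : vfield M) := forall x, D x (X x).

Definition dist_sum D E : forall x, set (tangent M x) := fun x =>
  [set v | exists2 u, D x u & exists2 w, E x w & v = u + w].
Arguments dist_sum D E x _ : clear implicits.

Definition complementary D E := forall x,
  dist_sum D E x = setT /\ D x `&` E x = [set 0].

End Distributions.
Arguments dist_sum {R d M} D E x _.

Section Forms.
Context {R : realType} {d : nat} (M : manifold R d).

Definition two_form_axiom
    (w : forall x : M, tangent M x -> tangent M x -> R) : Prop :=
  [/\ forall x (a : R) u v u', w x (a *: u + v) u' = a * w x u u' + w x v u',
      forall x (a : R) u v u', w x u' (a *: u + v) = a * w x u' u + w x u' v,
      forall x v, w x v v = 0
    & forall X Y : vfield M, smooth (fun x => w x (X x) (Y x))].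

Record two_form := TwoForm {
  form_fun :> forall x : M, tangent M x -> tangent M x -> R;
  form_funP : two_form_axiom form_fun }.

Definition form_eval (w : two_form) (X Y : vfield M) : M -> R :=
  fun x => w x (X x) (Y x).

Definition ext_deriv (w : two_form) (X Y Z : vfield M) : M -> R := fun x =>
  X x (form_eval w Y Z) - Y x (form_eval w X Z) + Z x (form_eval w X Y)
  - form_eval w (bracket X Y) Z x + form_eval w (bracket X Z) Y x
  - form_eval w (bracket Y Z) X x.

Definition closed_form (w : two_form) :=
  forall X Y Z x, ext_deriv w X Y Z x = 0.

Definition form_kernel (w : two_form) (x : M) : set (tangent M x) :=
  [set v | forall u, w x v u = 0].
Arguments form_kernel w x _ : clear implicits.

End Forms.
Arguments form_kernel {R d M} w x _.

Record k_symplectic (R : realType) (n k : nat) (M : manifold R (n * (k + 1)))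
    (omega : 'I_k -> two_form M) (L : forall x : M, set (tangent M x)) : Prop :=
  KSymplectic {
    ks_closed : forall alpha, closed_form (omega alpha);
    ks_foliation : foliation (n * k) L;
    ks_nondegenerate : forall x : M,
      \bigcap_alpha form_kernel (omega alpha) x = [set 0];
    ks_isotropic : forall X X' alpha, section_of L X -> section_of L X' ->
      forall x, form_eval (omega alpha) X X' x = 0 }.

Section Canonical.
Context {R : realType} {d k : nat} {M : manifold R d}.
Variable omega : 'I_k -> two_form M.
Implicit Types L Q : forall x : M, set (tangent M x).

Definition Lsub L (alpha : 'I_k) : forall x : M, set (tangent M x) := fun x =>
  if k == 1%N then L x
  else \bigcap_(beta in [set b | b != alpha]) form_kernel (omega beta) x.
Arguments Lsub L alpha x _ : clear implicits.

Definition psi alpha (Y Y' : vfield M) : vfield M -> M -> R := fun V x =>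
  Y x (form_eval (omega alpha) Y' V) - form_eval (omega alpha) Y' (bracket Y V) x.

(* [i_alpha^*] sends [Z] in [Gamma(Q)] to the section of [L_alpha^*] given on
   [Gamma(L_alpha)] by [form_eval (omega alpha) Z]; [vf0] is a junk value for
   the case where [theta] is not in the range. *)
Definition i_star_inv L Q alpha (theta : vfield M -> M -> R) : vfield M :=
  xget (vf0 M) [set Z | section_of Q Z /\
    forall X, section_of (Lsub L alpha) X ->
      form_eval (omega alpha) Z X = theta X].

End Canonical.
Arguments Lsub {R d k M} omega L alpha x _.

Section Connections.
Context {R : realType} {d : nat} {M : manifold R d}.
Variable nabla : vfield M -> vfield M -> vfield M.

(* R-linearity in the second argument is the Leibniz rule for constant f. *)
Definition linear_connection :=
  [/\ forall V W X, nabla (vf_add V W) X = vf_add (nabla V X) (nabla W X),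
      forall f (sf : smooth f) V X,
        nabla (vf_scale sf V) X = vf_scale sf (nabla V X),
      forall V X Y, nabla V (vf_add X Y) = vf_add (nabla V X) (nabla V Y)
    & forall f (sf : smooth f) V X x,
        nabla V (vf_scale sf X) x = V x f *: X x + f x *: nabla V X x].

Definition preserves (D : forall x : M, set (tangent M x)) :=
  forall V X, section_of D X -> section_of D (nabla V X).

Definition nabla_form (w : two_form M) (V X Y : vfield M) : M -> R := fun x =>
  V x (form_eval w X Y) - form_eval w (nabla V X) Y x
  - form_eval w X (nabla V Y) x.

Definition torsion (X Y : vfield M) (x : M) : tangent M x :=
  nabla X Y x - nabla Y X x - bracket X Y x.

End Connections.

(* Main.v *)
Require Import Defs.
From HB Require Import structures.
From mathcomp Require Import all_boot all_order all_algebra.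
From mathcomp Require Import all_classical all_reals all_analysis.
From mathcomp Require Import zify ring lra.
Set Implicit Arguments.
Unset Strict Implicit.
Unset Printing Implicit Defensive.
Import Order.TTheory GRing.Theory Num.Theory.
Import numFieldNormedType.Exports.
Local Open Scope classical_set_scope.
Local Open Scope ring_scope.

(* Near each point, L and Q have frames [E alpha j] of [L_alpha] and [F j] of Q
   that are dual to each other: [omega_beta (E alpha j, F l)] is 1 if
   [alpha = beta] and [j = l], and 0 otherwise.  Hence C^oo-linear maps on
   sections of Q (resp. [L_alpha]) are represented, through [omega_alpha], by
   sections of [L_alpha] (resp. Q).  The properties (1)-(3) force, for Y in
   Gamma(Q), X in Gamma(L_alpha) and V = V_L + V_Q,
     nabla_V Y = [V_L, Y]_Q + (i_alpha^* )^-1 (psi_alpha^(V_Q, Y)),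
     omega_alpha(nabla_V X, Y) = V (omega_alpha(X, Y)) - omega_alpha(X, nabla_V Y).
   The first line defines a connection on Q, the second one the connection on
   [L_alpha] dual to it, and their sum satisfies (1)-(3). *)

(** * Smooth functions on R^d *)

Section Smoothness.
Context {R : realType} {d : nat}.
Implicit Types (U : set 'rV[R]_d) (f g : 'rV[R]_d -> R).

(** Why the formulas are forced: for X in L and Y in Q, zero torsion reads nabla_X Y - nabla_Y X =
    [X, Y] with the first term in Q and the second in L, so it determines both. For Y, Y' in Q and X
    in L_alpha, nabla omega_alpha = 0 gives omega_alpha(nabla_Y Y', X) = Y (omega_alpha(Y', X)) -
    omega_alpha(Y', nabla_Y X). Here nabla_Y X may be replaced by [Y, X], from which it differs by
    the section nabla_X Y of the isotropic Q; the result is psi_alpha^(Y, Y') (X). Each alpha thus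
    prescribes nabla_Y Y' completely, and the assumption on the preimages of the psi_alpha is the
    compatibility of these k prescriptions. Condition (ii) puts the L-part of [Y, X] into L_alpha,
    where nabla_Y X has to be. The obstacle is that sections, brackets and connections are global
    objects while frames are local. Bump functions mediate: they extend frames to global sections
    and show that C^oo-linear maps are local. They rest in turn on the smoothness of exp (- 1 / t)
    at 0. *)

Lemma CkV m U f : open U -> (forall a, U a -> f a != 0) ->
  Ck m U f -> Ck m U (fun a => (f a)^-1).
Proof.
move=> oU f0; elim: m f f0 => [|m IH] f f0 Hf.
  by split=> // a Ua; apply: continuousV; [exact: f0 | exact: Hf.1].
have [cf Df] := Hf; split=> [a Ua|j].
  by apply: continuousV; [exact: f0 | exact: cf].
have [df Dfj] := Df j; split=> [a Ua|].
  by apply: derivableV; [exact: f0 | exact: df].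
have HV := IH _ f0 (CkS Hf).
have H := CkM oU (CkM oU (CkM oU HV HV) Dfj) (Ck_cst m U (-1)).
apply: Ck_ext H => // a Ua.
rewrite [RHS](@deriveV _ _ f)//; [|exact: f0|exact: df].
by rewrite /GRing.scale/= -exprVn expr2; ring.
Qed.

(** Restriction to the line [h *: v + a] reduces this to the chain rule in one variable, so that [g]
    need only be derivable in the direction [v]. *)
Lemma is_derive_comp1 (F : R -> R) (g : 'rV[R]_d -> R) a v dF :
  derivable g a v -> is_derive (g a) 1 F dF ->
  is_derive a v (F \o g) (dF * 'D_v g a).
Proof.
move=> dg dFg; pose G (h : R) := g (h *: v + a).
have derE (k : 'rV[R]_d -> R) :
    'D_v k a = 'D_1 (fun h : R => k (h *: v + a)) 0.
  rewrite /derive; set A := (fun h => _); set B := (fun h => _).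
  suff -> : A = B by [].
  by apply/funext => h; rewrite /A /B/= addr0 scale0r add0r [_%:A]mulr1.
have dG : is_derive (0 : R) 1 G ('D_v g a).
  by rewrite derE; apply/derivableP; case: (derivable1P g a v) => + _; exact.
have dF0 : is_derive (G 0) 1 F dF by rewrite /G scale0r add0r.
have [dFG dE] := is_derive1_comp dF0 dG.
apply: DeriveDef; last by rewrite derE.
by apply/derivable1P; exact: dFG.
Qed.

Definition flat (i : nat) (t : R) : R :=
  if 0 < t then t^-1 ^+ i * expR (- t^-1) else 0.

(** With s = 1 / t, the bound exp s >= s^(i+2) / (i+2)! gives s^i exp (- s) <= (i+2)! s^-2. A
    quadratic bound is what sends the difference quotient at 0 to 0. *)
Lemma flat_le i (t : R) : `|flat i t| <= (i.+2)`!%:R * t ^+ 2.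
Proof.
rewrite /flat; case: ifPn => [t0|_]; last by rewrite normr0 mulr_ge0// sqr_ge0.
have s0 : 0 < t^-1 by rewrite invr_gt0.
rewrite ger0_norm; last by rewrite mulr_ge0 ?expR_ge0// exprn_ge0// ltW.
rewrite expRN ler_pdivrMr ?expR_gt0//.
have fact0 : (0 : R) < (i.+2)`!%:R by rewrite ltr0n fact_gt0.
have : (t^-1) ^+ i.+2 / (i.+2)`!%:R <= expR t^-1.
  by apply: le_trans (expR_ge1Dxn i.+1 (ltW s0)); rewrite lerDr.
rewrite ler_pdivrMr// => H.
rewrite -(@ler_pM2l _ (t^-1 ^+ 2)) ?exprn_gt0// -exprD add2n.
apply: le_trans H _; rewrite [leRHS]mulrA mulrCA -exprMn.
by rewrite mulVf ?gt_eqF// expr1n mulr1 mulrC.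
Qed.

(* The derivatives of [exp (- 1 / t)] are combinations of the functions [flat i],
   so that proving smoothness for all [i] at once needs no closed form for them. *)
Lemma is_derive_flat i (t : R) :
  is_derive t 1 (flat i) (flat i.+2 t - i%:R * flat i.+1 t).
Proof.
have [t0|t0|->] := ltrgtP t 0.
- have -> : flat i.+2 t - i%:R * flat i.+1 t = 0.
    by rewrite /flat ltNge ltW// mulr0 subr0.
  apply: (@near_eq_is_derive _ _ _ (cst 0)).
  near=> u; rewrite /flat ifF//; apply/negbTE; rewrite -leNgt ltW//.
  by near: u; exact: lt_nbhsl.
- apply: (@near_eq_is_derive _ _ _ (fun u : R => u^-1 ^+ i * expR (- u^-1))).
    near=> u; rewrite /flat ifT//; near: u; exact: lt_nbhsr.
  have tN0 : t != 0 by rewrite gt_eqF.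
  have dV : is_derive t 1 (fun u : R => u^-1) (- t ^- 2).
    by apply: is_derive_eq (is_deriveV tN0 (is_derive_id t 1)) _; rewrite [LHS]mulr1.
  have dE : is_derive t 1 (fun u : R => expR (- u^-1)) (expR (- t^-1) * t ^- 2).
    apply: (@is_derive1_comp _ expR (fun u => - u^-1)).
    by apply: is_derive_eq; rewrite opprK.
  have dX : is_derive t 1 (fun u : R => u^-1 ^+ i) (i%:R * t^-1 ^+ i.-1 * - t ^- 2).
    have := is_deriveX i dV; rewrite exprfctE; exact.
  apply: is_derive_eq (is_deriveM dX dE) _.
  rewrite /flat t0 /GRing.scale/= -exprVn.
  case: i {dX} => [|i] /=; first by rewrite !mul0r !mulr0 expr0 subr0; ring.
  by rewrite !exprS expr0; ring.
- have f0 j : flat j 0 = 0 by rewrite /flat ltxx.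
  rewrite !f0 mulr0 subr0.
  suff H : (fun h : R => h^-1 *: ((flat i \o shift 0) (h *: 1) - flat i 0)) @ 0^' --> (0 : R).
    by apply: DeriveDef; [apply/cvg_ex; exists 0 | apply: cvg_lim H].
  apply/cvgrPdist_le => e e0; near=> h.
  have hN0 : h != 0 by near: h; exact: nbhs_dnbhs_neq.
  rewrite f0 sub0r normrN subr0 /= addr0 [h%:A]mulr1 /GRing.scale/= normrM normfV.
  rewrite ler_pdivrMl ?normr_gt0//; apply: le_trans (flat_le _ _) _.
  rewrite -real_normK ?num_real// expr2 mulrCA ler_wpM2l//.
  rewrite -ler_pdivlMl ?ltr0n ?fact_gt0//.
  near: h; apply: dnbhs0_le; rewrite mulr_gt0// invr_gt0 ltr0n fact_gt0//.
Unshelve. all: by end_near. Qed.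

Lemma Ck_flat i m U (g : 'rV[R]_d -> R) :
  open U -> Ck m U g -> Ck m U (flat i \o g).
Proof.
move=> oU; elim: m i g => [|m IH] i g Hg.
  split=> // a Ua; apply: continuous_comp; first exact: Hg.1.
  apply/differentiable_continuous/derivable1_diffP.
  by have [] := is_derive_flat i (g a).
have cflat : forall a, U a -> {for a, continuous (flat i \o g)}.
  move=> a Ua; apply: continuous_comp; first exact: Hg.1.
  apply/differentiable_continuous/derivable1_diffP.
  by have [] := is_derive_flat i (g a).
split=> // j; have [_ /(_ j)[dg Dg]] := Hg; split=> [a Ua|].
  by have [] := is_derive_comp1 (dg _ Ua) (is_derive_flat i (g a)).
have H1 := IH i.+1 _ (CkS Hg); have H2 := IH i.+2 _ (CkS Hg).
have := CkM oU (CkD oU H2 (CkM oU (Ck_cst m U (- i%:R)) H1)) Dg.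
apply: Ck_ext => // a Ua /=.
have [_ ->] := is_derive_comp1 (dg _ Ua) (is_derive_flat i (g a)).
by rewrite mulNr.
Qed.

End Smoothness.

Section SmoothStep.
Context {R : realType}.

Definition smooth_step (t : R) : R := flat 0 t / (flat 0 t + flat 0 (1 - t)).

Lemma flat_ge0 (t : R) : 0 <= flat 0 t.
Proof. by rewrite /flat; case: ifP => // _; rewrite mul1r expR_ge0. Qed.

Lemma flat_gt0 (t : R) : 0 < t -> 0 < flat 0 t.
Proof. by rewrite /flat => ->; rewrite mul1r expR_gt0. Qed.

Lemma smooth_step0 (t : R) : t <= 0 -> smooth_step t = 0.
Proof. by move=> t0; rewrite /smooth_step /flat ltNge t0 mul0r. Qed.

Lemma smooth_step1 (t : R) : 1 <= t -> smooth_step t = 1.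
Proof.
move=> t1; rewrite /smooth_step {3}/flat subr_gt0 ltNge t1/= addr0 divff//.
by rewrite gt_eqF// flat_gt0// (lt_le_trans ltr01).
Qed.

Lemma Ck_smooth_step d m (U : set 'rV[R]_d) g :
  open U -> Ck m U g -> Ck m U (smooth_step \o g).
Proof.
move=> oU Hg; apply: (CkM oU); first exact: Ck_flat.
have H1 : Ck m U (fun a => 1 - g a).
  have := CkD oU (Ck_cst m U 1) (CkM oU (Ck_cst m U (-1)) Hg).
  by apply: Ck_ext => // a _; rewrite mulN1r.
apply: CkV => //; last by apply: CkD => //; [exact: Ck_flat | exact: (Ck_flat 0 oU H1)].
(* [g a] and [1 - g a] are not both nonpositive, so the denominator of [smooth_step] is positive
   everywhere. *)
move=> a _; rewrite gt_eqF//=; have [g0|g0] := ltP 0 (g a).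
  by rewrite ltr_pwDl ?flat_gt0 ?flat_ge0.
by rewrite ltr_wpDl ?flat_ge0 ?flat_gt0// subr_gt0 (le_lt_trans g0).
Qed.

(** [Ck] is a conjunction of conditions at the single points of [U]; hence the sets [V] need not be
    open. *)
Lemma Ck_local d m (U : set 'rV[R]_d) f :
  (forall a, U a -> exists2 V, V a & Ck m V f) -> Ck m U f.
Proof.
elim: m f => [|m IH] f H.
  by split=> // a Ua; have [V Va [cf _]] := H a Ua; exact: cf.
split=> [a Ua|j]; first by have [V Va [cf _]] := H a Ua; exact: cf.
split=> [a Ua|].
  by have [V Va [_ /(_ j)[df _]]] := H a Ua; exact: df.
by apply: IH => a /H[V Va [_ /(_ j)[_ ?]]]; exists V.
Qed.

End SmoothStep.

(** * Bump functions *)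

Section SmoothAt.
Context {R : realType} {d : nat} {M : manifold R d}.
Implicit Types (x : M) (f g : M -> R).

Lemma smoothP f : (forall x, smooth_at x f) -> smooth f.
Proof.
move=> sf c Ac m; apply: Ck_local => _ [x [_ cx] <-].
have [U [oU Ux sU]] := sf x.
by exists (chart_map c @` (U `&` chart_dom c)); [exists x | exact: sU].
Qed.

Lemma smooth_atN x f : smooth_at x f -> smooth_at x (fun y => - f y).
Proof.
move=> sf; apply: smooth_at_ext (smooth_atM (smooth_at_cst x (-1)) sf).
by near=> y; rewrite mulN1r.
Unshelve. all: by end_near. Qed.

Lemma smooth_at_comp (op : R -> R) x f :
  (forall m (U : set 'rV[R]_d) F, open U -> Ck m U F -> Ck m U (op \o F)) ->
  smooth_at x f -> smooth_at x (op \o f).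
Proof.
move=> Hop sf; apply: (@smooth_at_op _ _ _ (fun a _ => op a) x f f) => // *.
exact: Hop.
Qed.

Lemma smooth_atV x f : (\forall y \near x, f y != 0) -> smooth_at x f ->
  smooth_at x (fun y => (f y)^-1).
Proof.
rewrite /prop_near1 nbhsE => -[V [oV Vx] f0] [U [oU Ux sU]].
have oI : open (U `&` V) by exact: openI.
exists (U `&` V); split=> // c Ac m; apply: (@CkV _ _ _ _ (f \o chart_inv c)).
- exact: chart_open_image.
- by move=> _ [y [[_ Vy] cy] <-] /=; rewrite chart_mapK ?inE//; exact: f0.
- by apply: (smooth_on_sub _ sU) => // y [].
Qed.

Lemma smooth_at_sum I (r : seq I) (P : pred I) (F : I -> M -> R) x :
  (forall i, P i -> smooth_at x (F i)) ->
  smooth_at x (fun y => \sum_(i <- r | P i) F i y).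
Proof.
move=> sF; elim: r => [|i r IH].
  by apply: smooth_at_ext (smooth_at_cst x 0); near=> y; rewrite big_nil.
have [Pi|Pi] := boolP (P i).
  apply: smooth_at_ext (smooth_atD (sF i Pi) IH).
  by near=> y; rewrite big_cons Pi.
by apply: smooth_at_ext IH; near=> y; rewrite big_cons (negbTE Pi).
Unshelve. all: by end_near. Qed.

Lemma smooth_at_prod I (r : seq I) (F : I -> M -> R) x :
  (forall i, smooth_at x (F i)) -> smooth_at x (fun y => \prod_(i <- r) F i y).
Proof.
move=> sF; elim: r => [|i r IH].
  by apply: smooth_at_ext (smooth_at_cst x 1); near=> y; rewrite big_nil.
apply: smooth_at_ext (smooth_atM (sF i) IH).
by near=> y; rewrite big_cons.
Unshelve. all: by end_near. Qed.

Lemma smooth_at_coord c j x : atlas M c -> chart_dom c x -> smooth_at x (Defs.coord c j).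
Proof.
move=> Ac cx; exists (chart_dom c); split=> //; first exact: chart_dom_open.
by move=> c' Ac' m; rewrite setIC; exact: atlas_compat.
Qed.

(** The last clause asks for vanishing near [y], not just at [y]: this makes the product of [phi]
    with data that are smooth on [U] alone smooth on all of [M]. *)
Lemma bump_function x (U : set M) : open U -> U x -> exists phi : M -> R,
  [/\ smooth phi, \forall y \near x, phi y = 1
    & forall y, U y \/ \forall z \near y, phi z = 0].
Proof.
move=> oU Ux; have [c Ac cx] := atlas_cover x.
pose a := chart_map c x.
have oO := chart_open_image (c := c) oU.
have /nbhs_ballP[e /= e0 eO] : nbhs a (chart_map c @` (U `&` chart_dom c)).
  by apply: open_nbhs_nbhs; split=> //; exists x.
pose r := e / 2; have r0 : 0 < r by rewrite divr_gt0.
pose B := [set v : 'rV[R]_d | forall j, `[a 0 j - r, a 0 j + r]%classic (v 0 j)].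
have BO : B `<=` chart_map c @` (U `&` chart_dom c).
  move=> v Bv; apply: eO; split=> // i j; rewrite ord1; have := Bv j.
  rewrite /= in_itv /= /ball /= /r => /andP[H1 H2].
  by rewrite ltr_norml; apply/andP; split; lra.
have cB : compact B by apply: (@rV_compact R d (fun j => `[a 0 j - r, a 0 j + r]%classic)) => j;
    exact: segment_compact.
pose K := chart_inv c @` B.
(* The Hausdorff property enters here: the compact set [K] is closed, so a function that vanishes
   off [K] is zero near each point outside [K]. *)
have cK : closed K.
  apply: compact_closed; first exact: manifold_hausdorff.
  apply: continuous_compact => //; apply: continuous_in_subspaceT => v /set_mem/BO[y [_ cy] yv].
  by apply: chart_inv_cont; exists y.
(* For the rescaled coordinate u, the value 2 - 2 u^2 is at least 1 when |u| <= 1/2 and at most 0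
   when |u| >= 1, which are the thresholds of [smooth_step]. *)
pose t j y := 2 - 2 * ((Defs.coord c j y - a 0 j) / r * ((Defs.coord c j y - a 0 j) / r)).
pose phi y := if `[< chart_dom c y >] then \prod_j smooth_step (t j y) else 0.
have KU y : K y -> U y /\ chart_dom c y.
  by move=> [_ /BO[z [Uz cz] <-] <-]; rewrite chart_mapK ?inE.
have phi0 y : ~ K y -> phi y = 0.
  rewrite /phi => nKy; case: asboolP => // cy.
  have [j] : exists j, ~ `[a 0 j - r, a 0 j + r]%classic (Defs.coord c j y).
    apply/existsNP => By; apply: nKy; exists (chart_map c y) => //.
    by rewrite chart_mapK ?inE.
  rewrite /= in_itv/= => nj; rewrite (bigD1 j)//= smooth_step0 ?mul0r//.
  rewrite /t; set u := Defs.coord c j y - a 0 j.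
  have ru : r <= `|u|.
    rewrite leNgt; apply/negP => ur; apply: nj.
    by move: ur; rewrite /u ltr_norml => /andP[H1 H2]; apply/andP; split; lra.
  have v1 : 1 <= `|u / r|.
    by rewrite normrM normfV (gtr0_norm r0) ler_pdivlMr// mul1r.
  have : 1 <= u / r * (u / r).
    by rewrite -expr2 -(real_normK (num_real _)) exprn_ege1.
  by lra.
exists phi; split.
- apply: smoothP => y; have [Ky|nKy] := pselect (K y); last first.
    apply: smooth_at_ext (smooth_at_cst y 0).
    have : nbhs y (~` K) by apply: open_nbhs_nbhs; split=> //; exact: closed_openC.
    by apply: filterS => z /phi0.
  have [_ cy] := KU _ Ky.
  apply: (@smooth_at_ext _ _ _ _ (fun y => \prod_j smooth_step (t j y))).
    have : nbhs y (chart_dom c).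
      by apply: open_nbhs_nbhs; split=> //; exact: chart_dom_open.
    by apply: filterS => z cz; rewrite /phi asboolT.
  apply: smooth_at_prod => j; apply: (smooth_at_comp (op := smooth_step)).
    by move=> *; exact: Ck_smooth_step.
  have su : smooth_at y (fun y => (Defs.coord c j y - a 0 j) / r).
    apply: smooth_atM; last exact: smooth_at_cst.
    by apply: smooth_atD; [exact: smooth_at_coord | exact: smooth_at_cst].
  apply: smooth_atD; first exact: smooth_at_cst.
  apply: smooth_atN; apply: smooth_atM; first exact: smooth_at_cst.
  exact: smooth_atM.
- have near1 : nbhs a (ball a (r / 2)) by apply: nbhsx_ballx; rewrite divr_gt0.
  have Hc : \forall y \near x, ball a (r / 2) (chart_map c y).
    exact: chart_map_cont cx _ near1.
  have Hd : \forall y \near x, chart_dom c y.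
    by apply: open_nbhs_nbhs; split=> //; exact: chart_dom_open.
  apply: filterS2 Hc Hd => y /= Hy cy; rewrite /phi asboolT// big1// => j _.
  apply: smooth_step1; have := Hy.2 0 j; rewrite /t /ball/= -/(Defs.coord c j y).
  rewrite distrC; set u := Defs.coord c j y - a 0 j => ur.
  have : `|u / r| <= 2^-1.
    by rewrite normrM normfV (gtr0_norm r0) ler_pdivrMr// mulrC ltW.
  by rewrite ler_norml => /andP[H1 H2]; nra.
- move=> y; have [/KU[Uy _]|nKy] := pselect (K y); [by left | right].
  have : nbhs y (~` K) by apply: open_nbhs_nbhs; split=> //; exact: closed_openC.
  by apply: filterS => z /phi0.
Qed.

End SmoothAt.

(** * Vector fields, distributions and forms *)

Section VectorFieldModule.
Context {R : realType} {d : nat} {M : manifold R d}.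
Implicit Types (X Y Z : vfield M) (x : M).

Lemma smooth_cst (a : R) : smooth ((fun=> a) : M -> R).
Proof. by apply: smoothP => x; exact: smooth_at_cst. Qed.

Definition vf_opp X := vf_scale (smooth_cst (-1)) X.

Fact vf_addA : associative (@vf_add R d M).
Proof. by move=> X Y Z; apply: vfieldP => x; exact: addrA. Qed.

Fact vf_addC : commutative (@vf_add R d M).
Proof. by move=> X Y; apply: vfieldP => x; exact: addrC. Qed.

Fact vf_add0 : left_id (vf0 M) (@vf_add R d M).
Proof. by move=> X; apply: vfieldP => x; exact: add0r. Qed.

Fact vf_addN : left_inverse (vf0 M) vf_opp (@vf_add R d M).
Proof. by move=> X; apply: vfieldP => x /=; rewrite scaleN1r addNr. Qed.

HB.instance Definition _ :=
  GRing.isZmodule.Build (vfield M) vf_addA vf_addC vf_add0 vf_addN.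

Lemma vf_scaleE f (sf : smooth f) X x : vf_scale sf X x = f x *: X x.
Proof. by []. Qed.

Lemma vf_addE X Y : vf_add X Y = X + Y. Proof. by []. Qed.

Lemma vfD X Y x : (X + Y) x = X x + Y x. Proof. by []. Qed.

Lemma vfN X x : (- X) x = - X x. Proof. by rewrite -scaleN1r. Qed.

Lemma vfB X Y x : (X - Y) x = X x - Y x. Proof. by rewrite vfD vfN. Qed.

Lemma vf_sum I (r : seq I) (P : pred I) (F : I -> vfield M) x :
  (\sum_(i <- r | P i) F i) x = \sum_(i <- r | P i) F i x.
Proof. exact: (big_morph (fun X : vfield M => X x)). Qed.

Lemma tangentD x (u v : tangent M x) f : (u + v) f = u f + v f.
Proof. by []. Qed.

Lemma tangentZ x a (u : tangent M x) f : (a *: u) f = a * u f.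
Proof. by []. Qed.

Lemma tangentB x (u v : tangent M x) f : (u - v) f = u f - v f.
Proof. by []. Qed.

(** The last clause is for distributions: if [e] takes values in a field of subspaces on [U], then
    [X] is a global section of it. *)
Lemma vf_extend x (U : set M) (e : forall y, tangent M y) : open U -> U x ->
  (forall y, U y -> smooth_section_at y e) ->
  exists X : vfield M, (\forall y \near x, X y = e y) /\
    forall y, X y = 0 \/ U y /\ exists c, X y = c *: e y.
Proof.
move=> oU Ux se; have [phi [sphi phi1 phi0]] := bump_function oU Ux.
have sX y : smooth_section_at y (fun z => phi z *: e z).
  move=> f sf; have [Uy|zy] := phi0 y.
    by apply: smooth_atM; [exact: smooth_smooth_at | exact: se].
  apply: smooth_at_ext (smooth_at_cst y 0).
  by apply: filterS zy => z /= ->; rewrite scale0r.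
exists (VField sX); split=> [|y].
  by apply: filterS phi1 => y /= ->; rewrite scale1r.
have [Uy|/nbhs_singleton zy] := phi0 y; first by right; split=> //; exists (phi y).
by left; rewrite /= zy scale0r.
Qed.

End VectorFieldModule.

Section Subspaces.
Context {R : realType} {d : nat} {M : manifold R d}.

Definition subspace x (S : set (tangent M x)) :=
  S 0 /\ forall (a : R) u v, S u -> S v -> S (a *: u + v).

Section Theory.
Variables (x : M) (S : set (tangent M x)).
Hypothesis subS : subspace S.

Lemma subspace0 : S 0. Proof. exact: subS.1. Qed.

Lemma subspaceD u v : S u -> S v -> S (u + v).
Proof. by move=> Su Sv; rewrite -[u]scale1r; exact: subS.2. Qed.

Lemma subspaceZ a u : S u -> S (a *: u).
Proof. by move=> Su; rewrite -[_ *: _]addr0; apply: subS.2 => //; exact: subspace0. Qed.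

Lemma subspaceN u : S u -> S (- u).
Proof. by rewrite -scaleN1r; exact: subspaceZ. Qed.

Lemma subspaceB u v : S u -> S v -> S (u - v).
Proof. by move=> Su /subspaceN; exact: subspaceD. Qed.

Lemma subspace_sum I (r : seq I) (P : pred I) (F : I -> tangent M x) :
  (forall i, P i -> S (F i)) -> S (\sum_(i <- r | P i) F i).
Proof. by move=> SF; apply: big_ind => //; [exact: subspace0 | exact: subspaceD]. Qed.

End Theory.

Lemma basis_subspace x (S : set (tangent M x)) r (b : 'I_r -> tangent M x) :
  is_basis S b -> subspace S.
Proof.
move=> [_ ->]; split.
  by exists (fun=> 0) => //; rewrite big1// => i _; rewrite scale0r.
move=> a _ _ [u _ <-] [v _ <-]; exists (fun i => a * u i + v i) => //.
rewrite scaler_sumr -big_split; apply: eq_bigr => i _ /=.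
by rewrite scalerDl scalerA.
Qed.

Variables (r : nat) (D : forall x : M, set (tangent M x)).
Arguments D : clear implicits.
Hypothesis distD : Defs.distribution r D.

Lemma distribution_subspace (x : M) : subspace (D x).
Proof. by have [U [X [_ Ux _ /(_ x Ux)/basis_subspace]]] := distD x. Qed.

(** The local frame is cut off, because [section_of], [bracket] and connections deal with global
    vector fields; in exchange it is a basis only near [x]. *)
Lemma distribution_frame (x : M) : exists e : 'I_r -> vfield M,
  (forall i, section_of D (e i)) /\
  \forall y \near x, is_basis (D y) (fun i => e i y).
Proof.
have [U [X [oU Ux sX bX]]] := distD x.
have /choice[e He] i := vf_extend oU Ux (fun y Uy => sX i y Uy).
exists e; split=> [i y|].
  have [->|[Uy [c ->]]] := (He i).2 y; first exact: subspace0 (distribution_subspace y).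
  apply: subspaceZ; first exact: distribution_subspace.
  rewrite (bX y Uy).2; exists (fun j => (j == i)%:R) => //.
  rewrite (bigD1 i)//= eqxx scale1r big1 ?addr0// => j /negbTE ->.
  by rewrite scale0r.
have eX : \forall y \near x, forall i, e i y = X i y.
  by apply: filter_forall => i; exact: (He i).1.
apply: filterS2 (open_nbhs_nbhs (conj oU Ux)) eX => y Uy ey.
rewrite (_ : (fun i => e i y) = (fun i => X i y)); first exact: bX.
exact/funext.
Qed.

(** It turns hypotheses on sections, such as isotropy, into statements about vectors at a point. *)
Lemma distribution_extend (x : M) v : D x v ->
  exists2 X : vfield M, section_of D X & X x = v.
Proof.
have [e [De /nbhs_singleton be]] := distribution_frame x.
rewrite be.2 => -[a _ <-]; exists (\sum_i vf_scale (smooth_cst (a i)) (e i)).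
  move=> y; rewrite vf_sum; apply: subspace_sum; first exact: distribution_subspace.
  by move=> i _; apply: subspaceZ; [exact: distribution_subspace | exact: De].
by rewrite vf_sum.
Qed.

End Subspaces.

Section FormTheory.
Context {R : realType} {d : nat} {M : manifold R d}.
Variables (w : two_form M) (x : M).
Implicit Types u v : tangent M x.

Lemma form_is_linear_r u : linear (w x u : tangent M x -> R^o).
Proof. by move=> a v v'; have [_ + _ _] := form_funP w; exact. Qed.

Lemma form_is_linear_l v : linear ((w x)^~ v : tangent M x -> R^o).
Proof. by move=> a u u'; have [+ _ _ _] := form_funP w; exact. Qed.

HB.instance Definition _ u := GRing.isLinear.Build R (tangent M x) R^o _
  (w x u : tangent M x -> R^o) (form_is_linear_r u).

Lemma formDr u v v' : w x u (v + v') = w x u v + w x u v'.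
Proof. exact: (linearD (w x u : tangent M x -> R^o)). Qed.

Lemma formZr u a v : w x u (a *: v) = a * w x u v.
Proof. exact: (linearZZ (w x u : tangent M x -> R^o)). Qed.

Lemma formNr u v : w x u (- v) = - w x u v.
Proof. exact: (linearN (w x u : tangent M x -> R^o)). Qed.

Lemma form0r u : w x u 0 = 0.
Proof. exact: (linear0 (w x u : tangent M x -> R^o)). Qed.

Lemma formBr u v v' : w x u (v - v') = w x u v - w x u v'.
Proof. exact: (linearB (w x u : tangent M x -> R^o)). Qed.

Lemma form_sumr u I (r : seq I) (P : pred I) (F : I -> tangent M x) :
  w x u (\sum_(i <- r | P i) F i) = \sum_(i <- r | P i) w x u (F i).
Proof. exact: (linear_sum (w x u : tangent M x -> R^o)). Qed.

Lemma formDl u u' v : w x (u + u') v = w x u v + w x u' v.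
Proof. by have := form_is_linear_l v 1 u u'; rewrite !scale1r. Qed.

Lemma form_alt u v : w x u v = - w x v u.
Proof.
have [_ _ alt _] := form_funP w; have := alt x (u + v).
by rewrite formDl !formDr !alt add0r addr0 => /eqP; rewrite addr_eq0 => /eqP.
Qed.

Lemma formZl a u v : w x (a *: u) v = a * w x u v.
Proof. by rewrite form_alt formZr -mulrN -form_alt. Qed.

Lemma form0l v : w x 0 v = 0.
Proof. by rewrite form_alt form0r oppr0. Qed.

Lemma formBl u u' v : w x (u - u') v = w x u v - w x u' v.
Proof. by rewrite form_alt formBr opprB addrC -!form_alt. Qed.

Lemma form_suml v I (r : seq I) (P : pred I) (F : I -> tangent M x) :
  w x (\sum_(i <- r | P i) F i) v = \sum_(i <- r | P i) w x (F i) v.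
Proof.
by rewrite form_alt form_sumr -sumrN; apply: eq_bigr => i _; rewrite -form_alt.
Qed.

End FormTheory.

Lemma form_smooth (R : realType) d (M : manifold R d) (w : two_form M) X Y :
  smooth (form_eval w X Y).
Proof. by have [_ _ _] := form_funP w; exact. Qed.

(** * Tensorial maps and duality *)

Section DualPair.
Context {R : realType} {d : nat} {M : manifold R d}.
Variables (w : two_form M).
Implicit Types (D : forall x : M, set (tangent M x)) (tau : vfield M -> M -> R).

(** Duality is encoded by expansion formulas rather than Kronecker relations: they show at once that
    a vector of [D] or [D'] is determined by its pairings, and they recover it smoothly from
    them. *)
Definition dual_pair r D D' := forall x : M, exists E F : 'I_r -> vfield M,
  [/\ forall j, section_of D (E j), forall j, section_of D' (F j)
    & \forall y \near x,
        (forall v, D y v -> v = \sum_j w y v (F j y) *: E j y) /\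
        (forall v, D' y v -> v = \sum_j w y (E j y) v *: F j y)].

Definition subspaces D := forall x, subspace (D x).

(** Exchanging the arguments of [w] costs a sign, which is absorbed into [- E j]. *)
Lemma dual_pair_sym r D D' : subspaces D -> dual_pair r D D' -> dual_pair r D' D.
Proof.
move=> subD pD x; have [E [F [DE DF near_EF]]] := pD x.
exists F, (fun j => - E j); split=> // [j y|].
  by rewrite vfN; apply: subspaceN => //; exact: DE.
apply: filterS near_EF => y [E1 F1]; split=> v Dv.
  by rewrite [LHS](F1 v Dv); apply: eq_bigr => j _; rewrite vfN formNr -form_alt.
rewrite [LHS](E1 v Dv); apply: eq_bigr => j _.
by rewrite vfN form_alt scaleNr scalerN.
Qed.

(** That is, [tau] restricts to a section of the dual bundle of [D]. Nothing is asked off the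
    sections of [D], since [tau] may be built from a connection on [D] alone. *)
Definition tensorial D tau :=
  [/\ forall X X', section_of D X -> section_of D X' ->
        forall x, tau (X + X') x = tau X x + tau X' x,
      forall f (sf : smooth f) X, section_of D X ->
        forall x, tau (vf_scale sf X) x = f x * tau X x
    & forall X, section_of D X -> smooth (tau X)].

Lemma section_sum D I (r : seq I) (P : pred I) (F : I -> vfield M) :
  subspaces D -> (forall i, P i -> section_of D (F i)) ->
  section_of D (\sum_(i <- r | P i) F i).
Proof. by move=> sD DF x; rewrite vf_sum; apply: subspace_sum => // i /DF; exact. Qed.

Lemma sectionZ D f (sf : smooth f) X :
  subspaces D -> section_of D X -> section_of D (vf_scale sf X).
Proof. by move=> sD DX x; apply: subspaceZ => //; exact: DX. Qed.

Lemma tensorial_sum D tau I (r : seq I) (F : I -> vfield M) x :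
  subspaces D -> tensorial D tau -> (forall i, section_of D (F i)) ->
  tau (\sum_(i <- r) F i) x = \sum_(i <- r) tau (F i) x.
Proof.
move=> sD [tauD tauZ _] DF; elim: r => [|i r IH].
  have D0 : section_of D 0 by move=> y; exact: subspace0.
  have := tauZ _ (smooth_cst 0) _ D0 x.
  rewrite mul0r big_nil big_nil => <-; congr (tau _ x).
  by apply: vfieldP => y /=; rewrite scaler0.
by rewrite !big_cons tauD ?IH//; exact: section_sum.
Qed.

(* Multiplying by a bump function identifies [X] and [X'] everywhere. *)
Lemma tensorial_near D tau X X' x : subspaces D -> tensorial D tau ->
  section_of D X -> section_of D X' -> (\forall y \near (x : M), X y = X' y) ->
  tau X x = tau X' x.
Proof.
move=> sD [tauD tauZ _] DX DX'; rewrite /prop_near1 nbhsE => -[U [oU Ux] XU].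
have [phi [sphi /nbhs_singleton phi1 phi0]] := bump_function oU Ux.
rewrite -[LHS]mul1r -[RHS]mul1r -phi1 -!(tauZ _ sphi)//.
congr (tau _ x); apply: vfieldP => y /=.
by have [/XU ->//|/nbhs_singleton ->] := phi0 y; rewrite !scale0r.
Qed.

Variables (r : nat) (D D' : forall x : M, set (tangent M x)).
Arguments D : clear implicits.
Arguments D' : clear implicits.
Hypotheses (subD : subspaces D) (subD' : subspaces D') (pDD' : dual_pair r D D').

Lemma dual_pair_inj x u v : D x u -> D x v ->
  (forall Y, section_of D' Y -> w x u (Y x) = w x v (Y x)) -> u = v.
Proof.
move=> Du Dv uv; have [E [F [DE DF /nbhs_singleton[E1 _]]]] := pDD' x.
by rewrite (E1 u Du) (E1 v Dv); apply: eq_bigr => j _; rewrite uv.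
Qed.

Lemma dual_pair_section_inj X Y : section_of D X -> section_of D Y ->
  (forall Z, section_of D' Z -> forall x, w x (X x) (Z x) = w x (Y x) (Z x)) ->
  X = Y.
Proof.
move=> DX DY XY; apply: vfieldP => x.
by apply: (dual_pair_inj (DX x) (DY x)) => Z DZ; exact: XY.
Qed.

(** Riesz representation through [w]: at [x] the vector with coefficients [tau (F j) x] in the frame
    [E] does it. All smooth objects below that are defined by their pairings (projections, preimages
    under i_alpha^* and dual connections) come from this lemma. *)
Lemma dual_pair_riesz tau : tensorial D' tau -> exists2 Z, section_of D Z &
  forall Y, section_of D' Y -> forall x, w x (Z x) (Y x) = tau Y x.
Proof.
move=> ttau; have [_ _ stau] := ttau.
have Hz x : exists z, D x z /\ forall Y, section_of D' Y -> w x z (Y x) = tau Y x.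
  have [E [F [DE DF nEF]]] := pDD' x.
  exists (\sum_j tau (F j) x *: E j x); split.
    by apply: subspace_sum => // j _; apply: subspaceZ => //; exact: DE.
  move=> Y DY; rewrite form_suml.
  (* [Y'] is a global section that agrees with [Y] near [x] only, hence the appeal to
     [tensorial_near]. *)
  pose Y' := \sum_j vf_scale (form_smooth w (E j) Y) (F j).
  have DYj j : section_of D' (vf_scale (form_smooth w (E j) Y) (F j)).
    exact: sectionZ.
  rewrite (@tensorial_near D' tau Y Y')//; last 2 first.
  - exact: section_sum.
  - apply: filterS nEF => y [_ /(_ _ (DY y)) {1}->].
    by rewrite vf_sum.
  rewrite (tensorial_sum _ _ subD' ttau)//; apply: eq_bigr => j _.
  by have [_ -> //] := ttau; rewrite formZl mulrC.
pose z x := sval (cid (Hz x)); have z_spec x := svalP (cid (Hz x)).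
rewrite -/(z _) in z_spec.
(* The values are chosen point by point, but their pairings are prescribed, so near [x] they are the
   combination of a single frame with coefficients [tau (F j)]. *)
have sz x : smooth_section_at x z.
  have [E [F [DE DF nEF]]] := pDD' x.
  move=> f sf; apply: (@smooth_at_ext _ _ _ _
      (fun y => (\sum_j vf_scale (stau _ (DF j)) (E j)) y f)); last exact: vf_smooth.
  apply: filterS nEF => y [E1 _]; congr (tangent_fun _ f).
  rewrite vf_sum [RHS](E1 _ (z_spec y).1); apply: eq_bigr => j _ /=.
  by rewrite (z_spec y).2.
exists (VField sz); first by move=> y; exact: (z_spec y).1.
by move=> Y DY y; exact: (z_spec y).2.
Qed.

End DualPair.

(** * Smoothness of determinants and of inverse matrices *)

Section SmoothMatrices.
Context {R : realType} {d : nat} {M : manifold R d}.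

Lemma smooth_at_det m (A : M -> 'M[R]_m) (x : M) :
  (forall i j, smooth_at x (fun y => A y i j)) -> smooth_at x (fun y => \det (A y)).
Proof.
move=> sA; apply: smooth_at_sum => s _.
by apply: smooth_atM; [exact: smooth_at_cst | exact: smooth_at_prod].
Qed.

Lemma smooth_at_invmx m (A : M -> 'M[R]_m) (x : M) i j :
  (forall i j, smooth_at x (fun y => A y i j)) ->
  (\forall y \near x, A y \in unitmx) ->
  smooth_at x (fun y => invmx (A y) i j).
Proof.
move=> sA uA.
apply: (@smooth_at_ext _ _ _ _
    (fun y => (\det (A y))^-1 * ((-1) ^+ (j + i) * \det (row' j (col' i (A y)))))).
  by apply: filterS uA => y uAy; rewrite /invmx uAy !mxE.
apply: smooth_atM.
  apply: smooth_atV; last exact: smooth_at_det.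
  by apply: filterS uA => y; rewrite unitmxE unitfE.
apply: smooth_atM; first exact: smooth_at_cst.
apply: smooth_at_det => i' j'.
by apply: smooth_at_ext (sA (lift j i') (lift i j')); near=> y; rewrite !mxE.
Unshelve. all: by end_near. Qed.

End SmoothMatrices.

(** * Adapted frames of a k-symplectic manifold *)

Section Polarized.
Context {R : realType} {n k d : nat} {M : manifold R d}.
Variables (omega : 'I_k -> two_form M) (L Q : forall x : M, set (tangent M x)).
Arguments L : clear implicits.
Arguments Q : clear implicits.
Hypotheses (k_gt0 : (0 < k)%N)
  (nondeg : forall x : M, \bigcap_alpha form_kernel (omega alpha) x = [set 0])
  (distL : Defs.distribution (n * k) L) (distQ : Defs.distribution n Q)
  (TM_LQ : complementary L Q)
  (isoL : forall X X' alpha, section_of L X -> section_of L X' ->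
     forall x, form_eval (omega alpha) X X' x = 0)
  (isoQ : forall X X' alpha, section_of Q X -> section_of Q X' ->
     forall x, form_eval (omega alpha) X X' x = 0).

Local Notation S alpha := (Lsub omega L alpha).

Lemma isotropicL alpha x u v : L x u -> L x v -> omega alpha x u v = 0.
Proof.
move=> /(distribution_extend distL)[X LX <-] /(distribution_extend distL)[Y LY <-].
exact: isoL.
Qed.

Lemma isotropicQ alpha x u v : Q x u -> Q x v -> omega alpha x u v = 0.
Proof.
move=> /(distribution_extend distQ)[X LX <-] /(distribution_extend distQ)[Y LY <-].
exact: isoQ.
Qed.

Lemma split_LQ x u : exists v w, [/\ L x v, Q x w & u = v + w].
Proof.
have : dist_sum L Q x u by rewrite (TM_LQ x).1.
by move=> [v Lv [w Qw ->]]; exists v, w.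
Qed.

Section Pointwise.
Variables (x : M) (e : 'I_(n * k) -> tangent M x) (f : 'I_n -> tangent M x).
Hypotheses (basis_e : is_basis (L x) e) (basis_f : is_basis (Q x) f).

(** The pairings with [L] vanish by isotropy and those with [Q] by assumption, so [u] lies in all
    the kernels. *)
Lemma L_eq0 u : L x u -> (forall beta l, omega beta x u (f l) = 0) -> u = 0.
Proof.
move=> Lu uf; have : [set 0] u; last by [].
rewrite -(nondeg x) => beta _ w; have [v [w' [Lv Qw' ->]]] := split_LQ w.
rewrite formDr isotropicL// add0r; move: Qw'; rewrite basis_f.2 => -[a _ <-].
by rewrite form_sumr big1// => l _; rewrite formZr uf mulr0.
Qed.

(* Row [i] lists the values of the [n * k] functionals [omega_alpha (-, f_j)] on
   [e_i]; by nondegeneracy these functionals separate the points of [L]. *)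
Definition gram : 'M[R]_(n * k) :=
  \matrix_(i < n * k) mxvec (\matrix_(j < n, alpha < k) omega alpha x (e i) (f j)).

Lemma gramE i j alpha : gram i (mxvec_index j alpha) = omega alpha x (e i) (f j).
Proof. by rewrite mxE mxvecE mxE. Qed.

Lemma gram_unit : gram \in unitmx.
Proof.
rewrite -row_free_unit; apply/inj_row_free => a aG.
suff /basis_e.1 a0 : \sum_i a 0 i *: e i = 0.
  by apply/rowP => i; rewrite a0 mxE.
apply: L_eq0 => [|beta l]; first by rewrite basis_e.2; exists (a 0).
rewrite form_suml; transitivity ((a *m gram) 0 (mxvec_index l beta)).
  by rewrite mxE; apply: eq_bigr => i _; rewrite formZl gramE.
by rewrite aG mxE.
Qed.

(** The basis of [L] dual to the functionals listed by [gram]: the basis [f] of [Q] is kept and only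
    the one of [L] is corrected. *)
Definition gram_dual alpha j :=
  \sum_i invmx gram (mxvec_index j alpha) i *: e i.

Lemma gram_dualL alpha j : L x (gram_dual alpha j).
Proof. by rewrite basis_e.2; eexists. Qed.

Lemma gram_dualE alpha beta j l :
  omega beta x (gram_dual alpha j) (f l) = ((alpha == beta) && (j == l))%:R.
Proof.
rewrite form_suml; transitivity
    ((invmx gram *m gram) (mxvec_index j alpha) (mxvec_index l beta)).
  by rewrite mxE; apply: eq_bigr => i _; rewrite formZl gramE.
rewrite mulVmx ?gram_unit// mxE /mxvec_index.
rewrite (inj_eq (@cast_ord_inj _ _ _)) (inj_eq enum_rank_inj).
by rewrite xpair_eqE andbC.
Qed.

End Pointwise.

Definition symplectic_frame_at (x : M)
    (e : 'I_k -> 'I_n -> tangent M x) (f : 'I_n -> tangent M x) :=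
  [/\ forall alpha beta j l,
        omega beta x (e alpha j) (f l) = ((alpha == beta) && (j == l))%:R,
      forall u, L x u -> u = \sum_alpha \sum_j omega alpha x u (f j) *: e alpha j
    & forall w, Q x w -> forall alpha, w = \sum_j omega alpha x (e alpha j) w *: f j].

Lemma symplectic_frame_of_basis (x : M) e f :
  is_basis (L x) e -> is_basis (Q x) f ->
  symplectic_frame_at (@gram_dual x e f) f.
Proof.
move=> be bf; split=> [alpha beta j l|u Lu|w]; first exact: gram_dualE.
- apply/eqP; rewrite -subr_eq0; apply/eqP/(L_eq0 bf) => [|beta l].
    have subL := distribution_subspace distL x.
    apply: subspaceB => //; do 2 (apply: subspace_sum => // ? _).
    by apply: subspaceZ => //; exact: gram_dualL.
  rewrite formBl form_suml (bigD1 beta)//= form_suml (bigD1 l)//=.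
  rewrite formZl gram_dualE// !eqxx mulr1 big1 => [|j jl].
    rewrite big1 ?addr0 ?subrr// => alpha ab; rewrite form_suml big1// => j _.
    by rewrite formZl gram_dualE// (negbTE ab) mulr0.
  by rewrite formZl gram_dualE// (negbTE jl) andbF mulr0.
rewrite bf.2 => -[a _ <-] alpha; apply: eq_bigr => j _; congr (_ *: _).
rewrite form_sumr (bigD1 j)//= formZr gram_dualE// !eqxx mulr1 big1 ?addr0//.
by move=> l lj; rewrite formZr gram_dualE// eq_sym (negbTE lj) andbF mulr0.
Qed.

Lemma symplectic_frame_exists (x : M) : exists e f,
  symplectic_frame_at e f /\ (forall alpha j, L x (e alpha j)) /\ (forall j, Q x (f j)).
Proof.
have [U [X [_ Ux _ /(_ x Ux) be]]] := distL x.
have [V [Y [_ Vx _ /(_ x Vx) bf]]] := distQ x.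
exists (gram_dual (fun i => X i x) (fun i => Y i x)), (fun i => Y i x).
split; [exact: symplectic_frame_of_basis | split=> [alpha j|j]].
  exact: gram_dualL.
rewrite bf.2; exists (fun l => (l == j)%:R) => //.
rewrite (bigD1 j)//= eqxx scale1r big1 ?addr0// => l /negbTE ->.
by rewrite scale0r.
Qed.

(* For [k = 1] the second condition is void, in accordance with [L_1 = L]; for
   [k > 1] the point is that the kernels alone already force [u] to lie in [L]. *)
Lemma LsubP alpha x u :
  S alpha x u <->
  L x u /\ forall beta, beta != alpha -> forall v, omega beta x u v = 0.
Proof.
rewrite /Lsub; case: ifPn => [/eqP k1|k1].
  split=> [Lu|[]//]; split=> // beta; rewrite -val_eqE/=.
  by have [] := (ltn_ord alpha, ltn_ord beta); lia.
split=> [Su|[_ Su] beta /= ba v]; last exact: Su.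
split=> [|beta ba v]; last exact: Su.
have [beta ba] : exists beta, beta != alpha.
  have k2 : (1 < k)%N by lia.
  have [a0|a0] := eqVneq (val alpha) 0.
    by exists (Ordinal k2); rewrite -val_eqE/= a0.
  by exists (Ordinal k_gt0); rewrite -val_eqE/= eq_sym.
have [v [w [Lv Qw uE]]] := split_LQ u.
have [e [f [[_ _ fE] [Le _]]]] := symplectic_frame_exists x.
suff w0 : w = 0 by rewrite uE w0 addr0.
rewrite (fE w Qw beta) big1// => j _.
have := Su beta ba (e beta j).
rewrite uE formDl isotropicL// add0r form_alt => /eqP.
by rewrite oppr_eq0 => /eqP ->; rewrite scale0r.
Qed.

Lemma Lsub_subspaces alpha : subspaces (S alpha).
Proof.
move=> x; have subL := distribution_subspace distL x; split.
  by apply/LsubP; split=> [|beta _ v]; [exact: subspace0 | rewrite form0l].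
move=> a u v /LsubP[Lu u0] /LsubP[Lv v0]; apply/LsubP; split; first exact: subL.2.
by move=> beta ba w; rewrite formDl formZl u0// v0// mulr0 addr0.
Qed.

Lemma gram_dualS (x : M) e f alpha j :
  is_basis (L x) e -> is_basis (Q x) f -> S alpha x (@gram_dual x e f alpha j).
Proof.
move=> be bf; apply/LsubP; split=> [|beta ba v]; first exact: gram_dualL.
have [u [w [Lu Qw ->]]] := split_LQ v.
rewrite formDr isotropicL//; last exact: gram_dualL.
move: Qw; rewrite bf.2 add0r => -[a _ <-].
rewrite form_sumr big1// => l _.
by rewrite formZr gram_dualE// eq_sym (negbTE ba) mulr0.
Qed.

(** The dual basis, taken at every point near [x], has the entries of an inverse Gram matrix as
    coefficients, hence is smooth; the cutoff only rescales its members, which stay in L_alpha. *)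
Lemma symplectic_frame (x : M) : exists E F,
  [/\ forall alpha j, section_of (S alpha) (E alpha j : vfield M),
      forall j, section_of Q (F j : vfield M)
    & \forall y \near x,
        symplectic_frame_at (fun alpha j => E alpha j y) (fun j => F j y)].
Proof.
have [e [Le near_e]] := distribution_frame distL x.
have [f [Qf near_f]] := distribution_frame distQ x.
have near_b : nbhs x [set y | is_basis (L y) (fun i => e i y) /\
                              is_basis (Q y) (fun i => f i y)].
  by apply: filterS2 near_e near_f.
rewrite nbhsE in near_b; have [U [oU Ux] bU] := near_b.
have nearU y : U y -> \forall z \near y, U z by move=> Uy; exact: open_nbhs_nbhs.
pose g alpha j y := gram_dual (fun i => e i y) (fun i => f i y) alpha j.
have sg alpha j y : U y -> smooth_section_at y (g alpha j).
  move=> Uy h sh.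
  apply: (@smooth_at_ext _ _ _ _ (fun z => \sum_i invmx
      (gram (fun i => e i z) (fun i => f i z)) (mxvec_index j alpha) i * e i z h)).
    near=> z; rewrite /g /gram_dual.
    by rewrite (big_morph (fun u : tangent M z => u h) (id1 := 0) (op1 := +%R)).
  apply: smooth_at_sum => i _; apply: smooth_atM; last exact: vf_smooth.
  apply: smooth_at_invmx => [i' s|].
    case/mxvec_indexP: s => l beta.
    apply: smooth_at_ext (smooth_smooth_at y (form_smooth (omega beta) (e i') (f l))).
    by near=> z; rewrite gramE.
  by apply: filterS (nearU y Uy) => z /bU[be bf]; exact: gram_unit.
have HE alpha j := vf_extend oU Ux (fun y Uy => sg alpha j y Uy).
pose E alpha j := sval (cid (HE alpha j)).
have [nE SE] : (forall alpha j, \forall y \near x, E alpha j y = g alpha j y) /\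
   forall alpha j, section_of (S alpha) (E alpha j).
  split=> alpha j; have [H1 H2] := svalP (cid (HE alpha j)); first exact: H1.
  move=> y; have [->|[Uy [c ->]]] := H2 y; first exact: subspace0 (Lsub_subspaces _ y).
  apply: subspaceZ; first exact: Lsub_subspaces.
  by have [be bf] := bU y Uy; exact: gram_dualS.
exists E, f; split=> //.
have nE' : \forall y \near x, forall p : 'I_k * 'I_n, E p.1 p.2 y = g p.1 p.2 y.
  by apply: filter_forall => p; exact: nE.
apply: filterS2 nE' (nearU x Ux) => y Ey /bU[be bf].
rewrite (_ : (fun alpha j => E alpha j y) = (fun alpha j => g alpha j y)).
  exact: symplectic_frame_of_basis.
by apply/funext => alpha; apply/funext => j; exact: (Ey (alpha, j)).
Unshelve. all: by end_near. Qed.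

(** The isomorphism i_alpha^* in terms of frames: in the expansion of a vector of L_alpha, the
    coefficients for beta != alpha are values of omega_beta on its own kernel. *)
Lemma Lsub_dual_pair alpha : dual_pair (omega alpha) n (S alpha) Q.
Proof.
move=> x; have [E [F [SE QF nEF]]] := symplectic_frame x.
exists (E alpha), F; split=> //; apply: filterS nEF => y [dEF LE FE].
split=> [v /LsubP[Lv v0]|v Qv]; last exact: FE.
rewrite [LHS](LE v Lv) (bigD1 alpha)//= [X in _ + X]big1 ?addr0//.
by move=> beta ba; rewrite big1// => j _; rewrite v0// scale0r.
Qed.

End Polarized.

(** * Brackets and connections *)

Section Bracket.
Context {R : realType} {d : nat} {M : manifold R d}.
Implicit Types (X Y Z : vfield M) (x : M).

Lemma tangent_eq x (u v : tangent M x) :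
  (forall h, smooth_at x h -> u h = v h) -> u = v.
Proof.
move=> uv; apply: val_inj; apply/funext => h /=.
by have [/uv//|nh] := pselect (smooth_at x h); rewrite !tangent_out.
Qed.

Lemma bracketE X Y x h : smooth_at x h ->
  bracket X Y x h = X x (fun y => Y y h) - Y x (fun y => X y h).
Proof. exact: bracket_funE. Qed.

Lemma bracketC X Y : bracket X Y = - bracket Y X.
Proof.
apply: vfieldP => x; rewrite vfN; apply: tangent_eq => h sh.
by rewrite -[RHS]/(- bracket Y X x h) !bracketE// opprB.
Qed.

Lemma bracketDr X Y Z : bracket X (Y + Z) = bracket X Y + bracket X Z.
Proof.
apply: vfieldP => x; apply: tangent_eq => h sh.
rewrite vfD tangentD !bracketE// vfD tangentD.
rewrite (_ : (fun y => (Y + Z) y h) = fun y => Y y h + Z y h)//.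
by rewrite tangent_add; [ring | exact: vf_smooth | exact: vf_smooth].
Qed.

Lemma bracketDl X Y Z : bracket (X + Y) Z = bracket X Z + bracket Y Z.
Proof.
by rewrite bracketC bracketDr opprD -!bracketC.
Qed.

Lemma bracketZr f (sf : smooth f) X Y x :
  bracket X (vf_scale sf Y) x = X x f *: Y x + f x *: bracket X Y x.
Proof.
apply: tangent_eq => h sh.
rewrite tangentD !tangentZ !bracketE// tangentZ.
rewrite (_ : (fun y => vf_scale sf Y y h) = fun y => f y * Y y h)//.
rewrite tangent_mul; [ring | exact: smooth_smooth_at | exact: vf_smooth].
Qed.

Lemma bracketZl f (sf : smooth f) X Y x :
  bracket (vf_scale sf X) Y x = f x *: bracket X Y x - Y x f *: X x.
Proof.
by rewrite bracketC vfN bracketZr opprD addrC (bracketC X) vfN scalerN.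
Qed.

Lemma bracket0l X : bracket 0 X = 0.
Proof.
by have := bracketDl 0 0 X; rewrite addr0 => /esym/eqP; rewrite addrC -subr_eq0 addrK => /eqP.
Qed.

Lemma bracket0r X : bracket X 0 = 0.
Proof. by rewrite bracketC bracket0l oppr0. Qed.

End Bracket.

(** * Connections on subbundles and their duals *)

Section DualConnection.
Context {R : realType} {d : nat} {M : manifold R d}.
Implicit Types (V W X Y Z : vfield M) (N : vfield M -> vfield M -> vfield M).

(** A connection on the vector bundle [D]. As [N] is a total function on vector fields, each axiom
    is confined to sections of [D]. *)
Definition connection_on (D : forall x : M, set (tangent M x)) N :=
  [/\ forall V X, section_of D X -> section_of D (N V X),
      forall V W X, section_of D X -> N (V + W) X = N V X + N W X,
      forall f (sf : smooth f) V X, section_of D X ->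
        N (vf_scale sf V) X = vf_scale sf (N V X),
      forall V X Y, section_of D X -> section_of D Y ->
        N V (X + Y) = N V X + N V Y
    & forall f (sf : smooth f) V X, section_of D X -> forall x,
        N V (vf_scale sf X) x = V x f *: X x + f x *: N V X x].

Lemma sectionD (D : forall x : M, set (tangent M x)) X Y :
  subspaces D -> section_of D X -> section_of D Y -> section_of D (X + Y).
Proof. by move=> sD DX DY x; exact: subspaceD. Qed.

Lemma sectionB (D : forall x : M, set (tangent M x)) X Y :
  subspaces D -> section_of D X -> section_of D Y -> section_of D (X - Y).
Proof. by move=> sD DX DY x; rewrite vfB; exact: subspaceB. Qed.

Variable w : two_form M.

Lemma form_evalDr X Y Z :
  form_eval w X (Y + Z) = fun x => form_eval w X Y x + form_eval w X Z x.
Proof. by apply/funext => x; exact: formDr. Qed.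

Lemma form_evalDl X Y Z :
  form_eval w (X + Y) Z = fun x => form_eval w X Z x + form_eval w Y Z x.
Proof. by apply/funext => x; exact: formDl. Qed.

Lemma form_evalZr f (sf : smooth f) X Y :
  form_eval w X (vf_scale sf Y) = fun x => f x * form_eval w X Y x.
Proof. by apply/funext => x; exact: formZr. Qed.

Lemma form_evalZl f (sf : smooth f) X Y :
  form_eval w (vf_scale sf X) Y = fun x => f x * form_eval w X Y x.
Proof. by apply/funext => x; exact: formZl. Qed.

Lemma form_smooth_at X Y x : smooth_at x (form_eval w X Y).
Proof. exact/smooth_smooth_at/form_smooth. Qed.

Lemma vf_form_evalDr V X Y Z x : V x (form_eval w X (Y + Z)) =
  V x (form_eval w X Y) + V x (form_eval w X Z).
Proof. by rewrite form_evalDr tangent_add//; exact: form_smooth_at. Qed.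

Lemma vf_form_evalDl V X Y Z x : V x (form_eval w (X + Y) Z) =
  V x (form_eval w X Z) + V x (form_eval w Y Z).
Proof. by rewrite form_evalDl tangent_add//; exact: form_smooth_at. Qed.

Lemma vf_form_evalZr f (sf : smooth f) V X Y x :
  V x (form_eval w X (vf_scale sf Y)) =
  f x * V x (form_eval w X Y) + w x (X x) (Y x) * V x f.
Proof.
rewrite form_evalZr tangent_mul//; first exact: smooth_smooth_at.
exact: form_smooth_at.
Qed.

Lemma vf_form_evalZl f (sf : smooth f) V X Y x :
  V x (form_eval w (vf_scale sf X) Y) =
  f x * V x (form_eval w X Y) + w x (X x) (Y x) * V x f.
Proof.
rewrite form_evalZl tangent_mul//; first exact: smooth_smooth_at.
exact: form_smooth_at.
Qed.

Lemma vf_form_alt V X Y x :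
  V x (form_eval w X Y) = - V x (form_eval w Y X).
Proof.
apply/eqP; rewrite -addr_eq0; apply/eqP.
have s0 : smooth_at x (fun=> 0 : R) by exact: smooth_at_cst.
rewrite -tangent_add; try exact: form_smooth_at.
rewrite (_ : (fun y => _) = (fun=> 0)).
  have := tangent_add (V x) s0 s0; rewrite (_ : (fun y : M => _) = (fun=> 0)).
    by move/eqP; rewrite -subr_eq0 opprD addrA subrr sub0r oppr_eq0 => /eqP.
  by apply/funext => y; rewrite addr0.
by apply/funext => y; rewrite /form_eval form_alt addNr.
Qed.

Lemma smooth_vf_form V X Y : smooth (fun x => V x (form_eval w X Y)).
Proof. by apply: smoothP => x; apply: vf_smooth; exact: form_smooth_at. Qed.

Lemma smoothB f g : smooth f -> smooth g -> smooth (fun x : M => f x - g x).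
Proof.
move=> sf sg; apply: smoothP => x.
by apply: smooth_atD; [|apply: smooth_atN]; exact: smooth_smooth_at.
Qed.

Variables (r : nat) (D D' : forall x : M, set (tangent M x)).
Arguments D : clear implicits.
Arguments D' : clear implicits.
Hypotheses (subD : subspaces D) (subD' : subspaces D') (pDD' : dual_pair w r D D').

Definition dual_connection N N' := forall V X Y, section_of D X ->
  section_of D' Y -> forall x,
  w x (N' V X x) (Y x) = V x (form_eval w X Y) - w x (X x) (N V Y x).

(** The Leibniz terms V f * w(X, Y) cancel in the right-hand side of [dual_connection], which is
    thus tensorial in Y and represented by a section of [D]. The axioms for [N'] are then checked on
    pairings with sections of [D']. *)
Lemma dual_connection_exists N : connection_on D' N ->
  exists2 N', connection_on D N' & dual_connection N N'.
Proof.
move=> [ND NDl NZl NDr NZr].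
pose tau V X Y x := V x (form_eval w X Y) - w x (X x) (N V Y x).
have ttau V X : section_of D X -> tensorial D' (tau V X).
  move=> DX; split=> [Y Y' DY DY' x|f sf Y DY x|Y DY].
  - by rewrite /tau NDr// vf_form_evalDr vfD formDr; ring.
  - by rewrite /tau vf_form_evalZr NZr// formDr !formZr; ring.
  - by apply: smoothB; [exact: smooth_vf_form | exact: form_smooth].
(* The default value 0 is taken at most when [X] is not a section of [D]. *)
pose N' V X := xget 0 [set Z | section_of D Z /\ forall Y, section_of D' Y ->
  forall x, w x (Z x) (Y x) = tau V X Y x].
have N'P V X : section_of D X -> section_of D (N' V X) /\
    forall Y, section_of D' Y -> forall x, w x (N' V X x) (Y x) = tau V X Y x.
  move=> DX; have [Z DZ ZE] := dual_pair_riesz subD subD' pDD' (ttau V X DX).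
  have : exists Z, section_of D Z /\ forall Y, section_of D' Y ->
    forall x, w x (Z x) (Y x) = tau V X Y x by exists Z.
  exact: xgetPex.
exists N'; last by move=> V X Y DX DY x; exact: (N'P V X DX).2.
have inj := dual_pair_section_inj pDD'.
have DN V X : section_of D X -> section_of D (N' V X) by move=> /(N'P V)[].
have NE V X Y x : section_of D X -> section_of D' Y ->
    w x (N' V X x) (Y x) = tau V X Y x.
  by move=> DX DY; exact: (N'P V X DX).2.
split=> [//|V W X DX|f sf V X DX|V X Y DX DY|f sf V X DX x].
- apply: inj => [||Z DZ x]; [exact: DN|by apply: sectionD => //; exact: DN|].
  by rewrite vfD formDl !NE// /tau NDl// !vfD tangentD formDr; ring.
- apply: inj => [||Z DZ x]; [exact: DN|by apply: sectionZ => //; exact: DN|].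
  by rewrite formZl !NE// /tau NZl// tangentZ formZr; ring.
- have DXY : section_of D (X + Y) by exact: sectionD.
  apply: inj => [||Z DZ x]; [exact: DN|by apply: sectionD => //; exact: DN|].
  by rewrite vfD formDl !NE// /tau vf_form_evalDl vfD formDl; ring.
- have DfX : section_of D (vf_scale sf X) by exact: sectionZ.
  apply: (dual_pair_inj pDD') => [||Z DZ]; first exact: DN.
    by apply: subspaceD; [|apply: subspaceZ|apply: subspaceZ] => //; exact: DN.
  by rewrite formDl !formZl !NE// /tau vf_form_evalZl formZl; ring.
Qed.

Lemma connection_on0 N V : subspaces D -> connection_on D N -> N V 0 = 0.
Proof.
move=> sD [_ _ _ ND _]; have D0 : section_of D 0 by move=> x; exact: subspace0.
by have := ND V 0 0 D0 D0; rewrite addr0 => /esym/eqP; rewrite addrC -subr_eq0 addrK => /eqP.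
Qed.

End DualConnection.

(** * The canonical connection *)

Section CanonicalConnection.
Context {R : realType} {n k d : nat} {M : manifold R d}.
Variables (omega : 'I_k -> two_form M) (L Q : forall x : M, set (tangent M x)).
Arguments L : clear implicits.
Arguments Q : clear implicits.
Hypotheses (k_gt0 : (0 < k)%N)
  (nondeg : forall x : M, \bigcap_alpha form_kernel (omega alpha) x = [set 0])
  (distL : Defs.distribution (n * k) L) (distQ : Defs.distribution n Q)
  (TM_LQ : complementary L Q)
  (isoL : forall X X' alpha, section_of L X -> section_of L X' ->
     forall x, form_eval (omega alpha) X X' x = 0)
  (isoQ : forall X X' alpha, section_of Q X -> section_of Q X' ->
     forall x, form_eval (omega alpha) X X' x = 0).

Local Notation S alpha := (Lsub omega L alpha).
Implicit Types (U V W X Y Z : vfield M).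

(** A fixed index: since [Q] is dual to every L_alpha, pairings with a single one of them determine
    a section of [Q]. *)
Let a0 : 'I_k := Ordinal k_gt0.

Let subL : subspaces L. Proof. exact: distribution_subspace distL. Qed.
Let subQ : subspaces Q. Proof. exact: distribution_subspace distQ. Qed.
Let subS alpha : subspaces (S alpha).
Proof. exact: (Lsub_subspaces k_gt0 nondeg distL distQ TM_LQ isoL). Qed.

Let LsubE := LsubP k_gt0 nondeg distL distQ TM_LQ isoL.

Let pairSQ alpha : dual_pair (omega alpha) n (S alpha) Q.
Proof. exact: (Lsub_dual_pair k_gt0 nondeg distL distQ TM_LQ isoL). Qed.

Let pairQS alpha : dual_pair (omega alpha) n Q (S alpha).
Proof. exact: dual_pair_sym. Qed.

Let SL alpha x u : S alpha x u -> L x u. Proof. by move=> /LsubE[]. Qed.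

Let formLL alpha x u v : L x u -> L x v -> omega alpha x u v = 0.
Proof. exact: (isotropicL distL isoL). Qed.

Let formQQ alpha x u v : Q x u -> Q x v -> omega alpha x u v = 0.
Proof. exact: (isotropicQ distQ isoQ). Qed.

Lemma LQ_eq0 x u : L x u -> Q x u -> u = 0.
Proof. by move=> Lu Qu; have : [set 0] u by rewrite -(TM_LQ x).2. Qed.

Lemma form_section_tensorial alpha D V : tensorial D (form_eval (omega alpha) V).
Proof.
split=> [X X' _ _ x|f sf X _ x|X _]; [|exact: formZr|exact: form_smooth].
by rewrite form_evalDr.
Qed.

Definition projQ V : vfield M :=
  xget 0 [set Z | section_of Q Z /\ section_of L (V - Z)].

(** Since [L] is isotropic, omega_a0(V, -) on L_a0 depends only on the Q-part of V; the section of
    [Q] that represents it is this part, and is smooth. *)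
Lemma projQP V : section_of Q (projQ V) /\ section_of L (V - projQ V).
Proof.
suff /xgetPex : exists Z, section_of Q Z /\ section_of L (V - Z) by exact.
have [Z QZ ZE] := dual_pair_riesz subQ (subS a0) (pairQS a0)
  (form_section_tensorial a0 _ V).
exists Z; split=> // x; rewrite vfB; have [v [w [Lv Qw VE]]] := split_LQ TM_LQ (V x).
suff -> : Z x = w by rewrite VE addrK.
apply: (dual_pair_inj (pairQS a0)) => // X SX.
rewrite ZE// /form_eval VE formDl formLL ?add0r//.
exact: SL.
Qed.

Lemma projQ_section V : section_of Q (projQ V). Proof. exact: (projQP V).1. Qed.

Lemma subr_projQ_section V : section_of L (V - projQ V).
Proof. exact: (projQP V).2. Qed.

Lemma projQ_unique V Z : section_of Q Z -> section_of L (V - Z) -> projQ V = Z.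
Proof.
move=> QZ LZ; have [QV LV] := projQP V.
apply/eqP; rewrite -subr_eq0; apply/eqP; apply: vfieldP => x.
apply: LQ_eq0; last exact: (sectionB subQ QV QZ).
rewrite (_ : (projQ V - Z) = (V - Z) - (V - projQ V)); last first.
  by rewrite opprB [RHS]addrC addrA subrK.
exact: (sectionB subL LZ LV).
Qed.

Lemma projQ_id Y : section_of Q Y -> projQ Y = Y.
Proof.
move=> QY; apply: projQ_unique => //; rewrite subrr => x; exact: subspace0.
Qed.

Lemma projQ_L X : section_of L X -> projQ X = 0.
Proof.
move=> LX; apply: projQ_unique; last by rewrite subr0.
by move=> x; exact: subspace0.
Qed.

Lemma projQD V W : projQ (V + W) = projQ V + projQ W.
Proof.
apply: projQ_unique; first by apply: sectionD => //; exact: projQ_section.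
rewrite opprD addrACA; apply: sectionD => //; exact: subr_projQ_section.
Qed.

Lemma projQZ f (sf : smooth f) V : projQ (vf_scale sf V) = vf_scale sf (projQ V).
Proof.
apply: projQ_unique; first by apply: sectionZ => //; exact: projQ_section.
move=> x; rewrite vfB /= -scalerBr -vfB; apply: subspaceZ => //.
exact: subr_projQ_section.
Qed.

Lemma form_projQ alpha V x u : L x u -> omega alpha x (projQ V x) u = omega alpha x (V x) u.
Proof.
move=> Lu; apply/eqP; rewrite eq_sym -subr_eq0 -formBl -vfB formLL//.
exact: subr_projQ_section.
Qed.

(** On [Q], the form omega_alpha(V, -) sees only the L_alpha-part of V: [Q] is isotropic and the
    other L_beta lie in the kernel of omega_alpha. *)
Definition projS alpha V : vfield M :=
  xget 0 [set Z | section_of (S alpha) Z /\ forall Y, section_of Q Y ->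
    forall x, omega alpha x (Z x) (Y x) = omega alpha x (V x) (Y x)].

Lemma projSP alpha V : section_of (S alpha) (projS alpha V) /\
  forall Y, section_of Q Y ->
    forall x, omega alpha x (projS alpha V x) (Y x) = omega alpha x (V x) (Y x).
Proof.
suff /xgetPex : exists Z, section_of (S alpha) Z /\ forall Y, section_of Q Y ->
    forall x, omega alpha x (Z x) (Y x) = omega alpha x (V x) (Y x) by exact.
have [Z QZ ZE] := dual_pair_riesz (subS alpha) subQ (pairSQ alpha)
  (form_section_tensorial alpha _ V).
by exists Z.
Qed.

Lemma projS_section alpha V : section_of (S alpha) (projS alpha V).
Proof. exact: (projSP alpha V).1. Qed.

Lemma form_projS alpha V x u : Q x u ->
  omega alpha x (projS alpha V x) u = omega alpha x (V x) u.
Proof.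
move=> /(distribution_extend distQ)[Y QY <-]; exact: (projSP alpha V).2.
Qed.

Lemma projS_unique alpha V Z : section_of (S alpha) Z ->
  (forall Y, section_of Q Y ->
    forall x, omega alpha x (V x) (Y x) = omega alpha x (Z x) (Y x)) ->
  projS alpha V = Z.
Proof.
move=> SZ ZE; apply: (dual_pair_section_inj (pairSQ alpha)) => //.
  exact: projS_section.
by move=> Y QY x; rewrite form_projS ?ZE//.
Qed.

Lemma projSD alpha V W : projS alpha (V + W) = projS alpha V + projS alpha W.
Proof.
apply: projS_unique; first by apply: sectionD => //; exact: projS_section.
by move=> Y QY x; rewrite !vfD !formDl !form_projS//.
Qed.

Lemma projSZ alpha f (sf : smooth f) V :
  projS alpha (vf_scale sf V) = vf_scale sf (projS alpha V).
Proof.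
apply: projS_unique; first by apply: sectionZ => //; exact: projS_section.
by move=> Y QY x; rewrite !formZl form_projS//.
Qed.

Lemma projS_id alpha X : section_of (S alpha) X -> projS alpha X = X.
Proof. by move=> SX; exact: projS_unique. Qed.

Lemma projS_neq alpha beta X : section_of (S alpha) X -> beta != alpha ->
  projS beta X = 0.
Proof.
move=> SX ba; apply: projS_unique => [x|Y QY x]; first exact: subspace0 (subS _ x).
by rewrite form0l; have [_ ->] := (LsubE alpha (X x)).1 (SX x).
Qed.

Lemma projS_Q alpha Y : section_of Q Y -> projS alpha Y = 0.
Proof.
move=> QY; apply: projS_unique => [x|Z QZ x]; first exact: subspace0 (subS _ x).
by rewrite form0l formQQ.
Qed.

Lemma sum_projS V : \sum_alpha projS alpha V = V - projQ V.
Proof.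
apply: vfieldP => x; rewrite vf_sum.
have LV := subr_projQ_section V x.
have [e [f [[_ eE _] [Le Qf]]]] := symplectic_frame_exists nondeg distL distQ TM_LQ isoL x.
have LP : L x (\sum_alpha projS alpha V x).
  by apply: subspace_sum => // alpha _; apply: SL; exact: projS_section.
rewrite [LHS](eE _ LP) [RHS](eE _ LV); apply: eq_bigr => alpha _.
apply: eq_bigr => j _; congr (_ *: _).
rewrite vfB formBl (formQQ _ (projQ_section V x))// subr0.
rewrite form_suml (bigD1 alpha)//= form_projS// big1 ?addr0// => beta ba.
have [_ ->//] := (LsubE beta _).1 (projS_section beta V x).
by rewrite eq_sym.
Qed.

Lemma projQ_projS V : V = \sum_alpha projS alpha V + projQ V.
Proof. by rewrite sum_projS subrK. Qed.

(** Of all blocks of omega_alpha, only those between L_alpha and [Q] survive. This reduces nabla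
    omega_alpha = 0 to the duality of the connections on L_alpha and [Q]. *)
Lemma form_split alpha V W x : omega alpha x (V x) (W x) =
  omega alpha x (projS alpha V x) (projQ W x) +
  omega alpha x (projQ V x) (projS alpha W x).
Proof.
have formL U U' : section_of L U ->
    omega alpha x (U x) (U' x) = omega alpha x (U x) (projQ U' x).
  move=> LU; rewrite form_alt -form_projQ; last exact: LU.
  by rewrite -form_alt.
rewrite -{1}(subrK (projQ V) V) vfD formDl; congr (_ + _).
  rewrite formL; last exact: subr_projQ_section.
  rewrite vfB formBl (formQQ _ (projQ_section V x)) ?subr0; last exact: projQ_section.
  by rewrite form_projS//; exact: projQ_section.
rewrite form_alt (form_alt _ (projQ V x)); congr (- _).
by rewrite form_projS//; exact: projQ_section.
Qed.

(** * Existence: the connection on Q, its duals and their sum *)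

Hypotheses
  (LQ_bracket : forall X Y alpha, section_of (S alpha) X -> section_of Q Y ->
     section_of (dist_sum (S alpha) Q) (bracket X Y))
  (psi_eq : forall Y Y', section_of Q Y -> section_of Q Y' -> forall alpha beta,
     i_star_inv omega L Q alpha (psi omega alpha Y Y') =
     i_star_inv omega L Q beta (psi omega beta Y Y')).

Lemma psi_tensorial alpha Y Y' : tensorial (S alpha) (psi omega alpha Y Y').
Proof.
split=> [X X' _ _ x|f sf X _ x|X _]; rewrite /psi.
- by rewrite vf_form_evalDr bracketDr /form_eval vfD formDr; ring.
- by rewrite vf_form_evalZr /form_eval bracketZr formDr !formZr; ring.
- by apply: smoothB; [exact: smooth_vf_form | exact: form_smooth].
Qed.

Definition istar Y Y' := i_star_inv omega L Q a0 (psi omega a0 Y Y').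

(** Each psi_alpha is represented by a section of [Q], so [i_star_inv] does not return its junk
    value; [psi_eq] then lets one field represent all of them. *)
Lemma istarP alpha Y Y' : section_of Q Y -> section_of Q Y' ->
  section_of Q (istar Y Y') /\ forall X, section_of (S alpha) X ->
    forall x, omega alpha x (istar Y Y' x) (X x) = psi omega alpha Y Y' X x.
Proof.
move=> QY QY'; rewrite /istar (psi_eq QY QY' a0 alpha) /i_star_inv.
have [Z QZ ZE] := dual_pair_riesz subQ (subS alpha) (pairQS alpha)
  (psi_tensorial alpha Y Y').
have /xgetPex : exists Z, section_of Q Z /\ forall X, section_of (S alpha) X ->
    form_eval (omega alpha) Z X = psi omega alpha Y Y' X.
  by exists Z; split=> // X SX; apply/funext => x; exact: ZE.
move=> /(_ (vf0 M))[QI IE]; split=> // X SX x.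
by rewrite -(IE X SX).
Qed.

Definition connQ V Y := projQ (bracket (V - projQ V) Y) + istar (projQ V) Y.

Lemma connQ_section V Y : section_of Q Y -> section_of Q (connQ V Y).
Proof.
move=> QY; apply: sectionD => //; first exact: projQ_section.
by have [] := istarP a0 (projQ_section V) QY.
Qed.

(** Pairing with L_alpha removes the projection and the chosen preimage; what remains is explicit,
    and the axioms of a connection are checked on it. *)
Lemma connQ_form alpha V Y X x : section_of Q Y -> section_of (S alpha) X ->
  omega alpha x (connQ V Y x) (X x) =
  omega alpha x (bracket (V - projQ V) Y x) (X x) + psi omega alpha (projQ V) Y X x.
Proof.
move=> QY SX; have [_ IE] := istarP alpha (projQ_section V) QY.
by rewrite vfD formDl IE// form_projQ//; apply: SL; exact: SX.
Qed.

Lemma connQ_connection : connection_on Q connQ.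
Proof.
have inj := dual_pair_section_inj (pairQS a0).
split; first by move=> V X; exact: connQ_section.
- move=> V W Y QY; apply: inj => [||X SX x]; first exact: connQ_section.
    by apply: sectionD => //; exact: connQ_section.
  rewrite vfD formDl !connQ_form// projQD /psi opprD addrACA !bracketDl /form_eval.
  by rewrite !vfD tangentD formDl formDr; ring.
- move=> f sf V Y QY; apply: inj => [||X SX x]; first exact: connQ_section.
    by apply: sectionZ => //; exact: connQ_section.
  have PZ : vf_scale sf V - vf_scale sf (projQ V) = vf_scale sf (V - projQ V).
    by apply: vfieldP => y; rewrite vfB -[RHS]/(f y *: (V - projQ V) y) vfB scalerBr.
  rewrite formZl !connQ_form// projQZ PZ /psi /form_eval !bracketZl tangentZ.
  rewrite !formBl !formBr !formZl !formZr.
  (* The derivatives of [f] disappear: (Y f) V_L pairs to zero with [X] in [L], and (X f) V_Q with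
     [Y] in [Q]. *)
  rewrite (formLL _ (subr_projQ_section V x) (SL (SX x))).
  by rewrite (formQQ _ (QY x) (projQ_section V x)); ring.
- move=> V Y Y' QY QY'; have QYY : section_of Q (Y + Y') by exact: sectionD.
  apply: inj => [||X SX x]; first exact: connQ_section.
    by apply: sectionD => //; exact: connQ_section.
  rewrite vfD formDl !connQ_form// /psi vf_form_evalDl bracketDr /form_eval.
  by rewrite !vfD !formDl; ring.
- move=> f sf V Y QY x; have QfY : section_of Q (vf_scale sf Y) by exact: sectionZ.
  have QcY : section_of Q (connQ V Y) by exact: connQ_section.
  apply: (dual_pair_inj (pairQS a0)) => [||X SX]; first exact: connQ_section.
    by apply: subspaceD; [|apply: subspaceZ|apply: subspaceZ].
  rewrite [RHS]formDl !formZl !connQ_form// /psi vf_form_evalZl bracketZr /form_eval.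
  (* The bracket yields the derivative of [f] along V_L and psi the one along V_Q; together they
     make V f. *)
  rewrite formDl !formZl vfB tangentB; ring.
Qed.

Lemma connS_exists alpha : exists2 N,
  connection_on (S alpha) N & dual_connection (omega alpha) (S alpha) Q connQ N.
Proof.
exact: (dual_connection_exists (subS alpha) subQ (pairSQ alpha) connQ_connection).
Qed.

Definition connS alpha := s2val (cid2 (connS_exists alpha)).

Lemma connS_connection alpha : connection_on (S alpha) (connS alpha).
Proof. exact: (s2valP (cid2 (connS_exists alpha))). Qed.

Lemma connS_dual alpha :
  dual_connection (omega alpha) (S alpha) Q connQ (connS alpha).
Proof. exact: (s2valP' (cid2 (connS_exists alpha))). Qed.

Lemma connS_section alpha V X :
  section_of (S alpha) X -> section_of (S alpha) (connS alpha V X).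
Proof. by have [+ _ _ _ _] := connS_connection alpha; exact. Qed.

Definition canonical_connection V X :=
  \sum_alpha connS alpha V (projS alpha X) + connQ V (projQ X).

Lemma canonical_linear_connection : linear_connection canonical_connection.
Proof.
have [_ QDl QZl QDr QL] := connQ_connection; rewrite /canonical_connection.
split=> [V W X|f sf V X|V X Y|f sf V X x].
- rewrite !vf_addE QDl; last exact: projQ_section.
  rewrite [RHS]addrACA -big_split/=; congr (_ + _); apply: eq_bigr => alpha _.
  by have [_ -> //] := connS_connection alpha; exact: projS_section.
- rewrite QZl; last exact: projQ_section.
  apply: vfieldP => x; rewrite vfD vf_sum.
  rewrite [RHS]vf_scaleE vfD vf_sum scalerDr scaler_sumr.
  congr (_ + _); apply: eq_bigr => alpha _.
  by have [_ _ -> //] := connS_connection alpha; exact: projS_section.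
- rewrite !vf_addE projQD QDr; [|exact: projQ_section|exact: projQ_section].
  rewrite [RHS]addrACA -big_split/=; congr (_ + _); apply: eq_bigr => alpha _.
  by have [_ _ _ + _] := connS_connection alpha; rewrite projSD => -> //; exact: projS_section.
- rewrite vfD projQZ QL; last exact: projQ_section.
  have XE : X x = \sum_alpha projS alpha X x + projQ X x.
    by rewrite {1}(projQ_projS X) vfD vf_sum.
  rewrite vf_sum (vfD (\sum_alpha connS alpha V (projS alpha X))) vf_sum XE !scalerDr !scaler_sumr.
  rewrite [RHS]addrACA -big_split/=; congr (_ + _); apply: eq_bigr => alpha _.
  by have [_ _ _ _ +] := connS_connection alpha; rewrite projSZ => -> //; exact: projS_section.
Qed.

Lemma connS0 alpha V : connS alpha V 0 = 0.
Proof. exact: connection_on0 (subS alpha) (connS_connection alpha). Qed.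

Lemma connQ0 V : connQ V 0 = 0.
Proof. exact: connection_on0 subQ connQ_connection. Qed.

Lemma canonical_connectionS alpha V X : section_of (S alpha) X ->
  canonical_connection V X = connS alpha V X.
Proof.
move=> SX; rewrite /canonical_connection (bigD1 alpha)//= projS_id//.
rewrite big1 => [|beta ba]; last by rewrite (projS_neq SX ba) connS0.
by rewrite projQ_L ?connQ0 ?addr0// => x; exact: SL.
Qed.

Lemma canonical_connectionQ V Y : section_of Q Y ->
  canonical_connection V Y = connQ V Y.
Proof.
move=> QY; rewrite /canonical_connection projQ_id// big1 ?add0r// => alpha _.
by rewrite projS_Q// connS0.
Qed.

Lemma projQ_canonical V X : projQ (canonical_connection V X) = connQ V (projQ X).
Proof.
apply: projQ_unique; first by apply: connQ_section; exact: projQ_section.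
rewrite addrK; apply: section_sum => // alpha _ x; apply: SL.
by apply: connS_section; exact: projS_section.
Qed.

Lemma projS_canonical alpha V X :
  projS alpha (canonical_connection V X) = connS alpha V (projS alpha X).
Proof.
have SN beta := connS_section V (projS_section beta X).
apply: projS_unique => // Y QY x; rewrite vfD formDl vf_sum form_suml.
rewrite (formQQ _ (connQ_section V (projQ_section X) x))// addr0.
rewrite (bigD1 alpha)//= big1 ?addr0// => beta ba.
by have [_ ->//] := (LsubE beta _).1 (SN beta x); rewrite eq_sym.
Qed.

(** After [form_split], each of the two blocks is parallel by [connS_dual], the second one up to
    exchanging the arguments. *)
Lemma canonical_metric alpha V X Y x :
  nabla_form canonical_connection (omega alpha) V X Y x = 0.
Proof.
rewrite /nabla_form.
have -> : form_eval (omega alpha) X Y = fun y =>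
    form_eval (omega alpha) (projS alpha X) (projQ Y) y +
    form_eval (omega alpha) (projQ X) (projS alpha Y) y.
  by apply/funext => y; exact: form_split.
rewrite tangent_add; try exact: form_smooth_at.
rewrite {3 4}/form_eval.
rewrite (form_split _ (canonical_connection V X)) (form_split _ X (canonical_connection V Y)).
rewrite !projQ_canonical !projS_canonical.
have QX := projQ_section X; have QY := projQ_section Y.
have SX := projS_section alpha X; have SY := projS_section alpha Y.
rewrite (connS_dual V SX QY) (form_alt _ (projQ X x)) (connS_dual V SY QX).
rewrite (form_alt _ (projS alpha Y x)) -!/(form_eval _ _ _).
by rewrite (vf_form_alt _ _ (projQ X)); ring.
Qed.

Lemma connQ_L X Y : section_of L X -> section_of Q Y ->
  connQ X Y = projQ (bracket X Y).
Proof.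
move=> LX QY; apply: (dual_pair_section_inj (pairQS a0)).
- exact: connQ_section.
- exact: projQ_section.
move=> Z SZ x; rewrite connQ_form// form_projQ; last exact: SL.
by rewrite projQ_L// subr0 /psi /form_eval bracket0l form0r subr0 addr0.
Qed.

Lemma connQ_Q Y Y' : section_of Q Y -> section_of Q Y' -> connQ Y Y' = istar Y Y'.
Proof.
move=> QY QY'; rewrite /connQ (projQ_id QY) subrr bracket0l projQ_L ?add0r//.
by move=> x; exact: subspace0.
Qed.

(** This is what psi_alpha is designed for: inserted into the duality formula, its derivative term
    cancels the other one and leaves omega_alpha([Y, Z], Y'). *)
Lemma connS_Q alpha Y Z : section_of Q Y -> section_of (S alpha) Z ->
  connS alpha Y Z = projS alpha (bracket Y Z).
Proof.
move=> QY SZ; apply/esym/projS_unique => [|Y' QY' x]; first exact: connS_section.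
rewrite (connS_dual _ SZ QY') connQ_Q// [X in _ - X]form_alt.
have [_ ->//] := istarP alpha QY QY'.
by rewrite /psi /form_eval -/(form_eval _ _ _) (vf_form_alt _ _ Z) (form_alt _ (Y' x)); ring.
Qed.

Lemma projS_dist_sum alpha W : section_of (dist_sum (S alpha) Q) W ->
  projS alpha W = W - projQ W.
Proof.
move=> SQW; rewrite -sum_projS (bigD1 alpha)//= big1 ?addr0// => beta ba.
apply: projS_unique => [x|Y QY x]; first exact: subspace0 (subS _ x).
have [u Su [v Qv ->]] := SQW x; rewrite form0l formDl (formQQ _ Qv)// addr0.
by have [_ ->] := (LsubE alpha u).1 Su.
Qed.

(** Here nabla_X Y is the Q-part of [X, Y], and nabla_Y X is the sum of the L_alpha-parts of the
    [Y, X_alpha]. By [LQ_bracket] each of these is the full L-part, so the sum is the L-part of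
    [Y, X]. *)
Lemma canonical_torsion X Y : section_of L X -> section_of Q Y ->
  forall x, torsion canonical_connection X Y x = 0.
Proof.
move=> LX QY x; rewrite /torsion canonical_connectionQ// connQ_L//.
have -> : canonical_connection Y X = bracket Y X - projQ (bracket Y X).
  have {2 3}-> : X = \sum_alpha projS alpha X by rewrite sum_projS projQ_L// subr0.
  rewrite /canonical_connection (projQ_L LX) connQ0 addr0.
  rewrite (big_morph (bracket Y) (bracketDr Y) (bracket0r Y)).
  rewrite (big_morph projQ projQD (projQ_L (X := 0) (fun x => subspace0 (subL x)))).
  rewrite -sumrB; apply: eq_bigr => alpha _.
  have SX := projS_section alpha X.
  rewrite connS_Q// projS_dist_sum// bracketC => y.
  have [u Su [v Qv uv]] := LQ_bracket SX QY y.
  exists (- u); first exact: (subspaceN (subS alpha y)).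
  by exists (- v); [exact: subspaceN | rewrite vfN uv opprD].
have PC : projQ (- bracket X Y) = - projQ (bracket X Y).
  apply: projQ_unique => [y|y].
    by rewrite vfN; apply: subspaceN => //; exact: projQ_section.
  by rewrite -opprD vfN; apply: subspaceN => //; exact: subr_projQ_section.
by rewrite vfB (bracketC Y) PC !vfN opprB opprK addrA subrr add0r subrr.
Qed.

(** * Uniqueness *)

Section Uniqueness.
Variable N : vfield M -> vfield M -> vfield M.
Hypotheses (linN : linear_connection N)
  (presS : forall alpha, preserves N (S alpha)) (presQ : preserves N Q)
  (metricN : forall alpha V X Y x, nabla_form N (omega alpha) V X Y x = 0)
  (torsionN : forall X Y, section_of L X -> section_of Q Y ->
     forall x, torsion N X Y x = 0).

Let NDl V W X : N (V + W) X = N V X + N W X.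
Proof. by have [+ _ _ _] := linN; exact. Qed.

Let NDr V X Y : N V (X + Y) = N V X + N V Y.
Proof. by have [_ _ + _] := linN; exact. Qed.

Let N0r V : N V 0 = 0.
Proof.
by have := NDr V 0 0; rewrite addr0 => /esym/eqP; rewrite addrC -subr_eq0 addrK => /eqP.
Qed.

Let N_projS V X : N V X = \sum_alpha N V (projS alpha X) + N V (projQ X).
Proof. by rewrite {1}(projQ_projS X) NDr (big_morph (N V) (NDr V) (N0r V)). Qed.

Let N_L V X : section_of L X -> section_of L (N V X).
Proof.
move=> LX; rewrite N_projS projQ_L// N0r addr0; apply: section_sum => // alpha _ x.
by apply: SL; apply: presS; exact: projS_section.
Qed.

Let N_form alpha V X Y x : omega alpha x (N V X x) (Y x) =
  V x (form_eval (omega alpha) X Y) - omega alpha x (X x) (N V Y x).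
Proof.
have := metricN alpha V X Y x; rewrite /nabla_form => /eqP.
by rewrite addrAC subr_eq0 => /eqP ->.
Qed.

Let N_bracket U Y : section_of L U -> section_of Q Y ->
  N Y U = N U Y - bracket U Y.
Proof.
move=> LU QY; apply: vfieldP => x; have /eqP := torsionN LU QY x.
by rewrite /torsion addrAC subr_eq0 vfB => /eqP.
Qed.

Let N_LQ U Y : section_of L U -> section_of Q Y -> N U Y = projQ (bracket U Y).
Proof.
move=> LU QY; apply/esym/projQ_unique; first exact: presQ.
rewrite -opprB -N_bracket// => x; rewrite vfN; apply: subspaceN => //.
exact: N_L.
Qed.

Let N_QQ Y Y' : section_of Q Y -> section_of Q Y' -> N Y Y' = istar Y Y'.
Proof.
move=> QY QY'; have [QI IE] := istarP a0 QY QY'.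
apply: (dual_pair_section_inj (pairQS a0)) => [||X SX x] //; first exact: presQ.
have LX : section_of L X by move=> y; exact: SL.
(* Metric compatibility, then zero torsion; the term with [N X Y] drops because it lies in [Q], as
   [Y'] does. *)
rewrite IE// N_form N_bracket// vfB formBr (formQQ _ (QY' x)); last exact: presQ.
by rewrite (bracketC X) vfN formNr opprK add0r.
Qed.

Lemma canonical_connection_unique : canonical_connection = N.
Proof.
have N_Q V Y : section_of Q Y -> connQ V Y = N V Y.
  move=> QY; rewrite -[V in N V Y](subrK (projQ V)) NDl N_LQ//.
    by rewrite N_QQ//; exact: projQ_section.
  exact: subr_projQ_section.
apply/funext => V; apply/funext => X; rewrite N_projS; congr (_ + _).
  apply: eq_bigr => alpha _; have SX := projS_section alpha X.
  apply: (dual_pair_section_inj (pairSQ alpha)) => [||Y QY x].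
  - exact: connS_section.
  - exact: presS.
  - by rewrite (connS_dual _ SX QY) N_form N_Q.
by apply: N_Q; exact: projQ_section.
Qed.

End Uniqueness.

End CanonicalConnection.

Theorem theorem3p3 (R : realType) (n k : nat) (k_gt0 : (0 < k)%N)
    (M : manifold R (n * (k + 1)))
    (omega : 'I_k -> two_form M) (L Q : forall x : M, set (tangent M x))
    (kM : k_symplectic omega L)
    (intQ : integrable_distribution n Q)
    (TM_LQ : complementary L Q)
    (isoQ : forall Y Y' alpha, section_of Q Y -> section_of Q Y' ->
       forall x, form_eval (omega alpha) Y Y' x = 0)
    (LQ_bracket : forall X Y alpha,
       section_of (Lsub omega L alpha) X -> section_of Q Y ->
       section_of (dist_sum (Lsub omega L alpha) Q) (bracket X Y))
    (psi_eq : forall Y Y', section_of Q Y -> section_of Q Y' ->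
       forall alpha beta,
         i_star_inv omega L Q alpha (psi omega alpha Y Y') =
         i_star_inv omega L Q beta (psi omega beta Y Y')) :
  exists! nabla : vfield M -> vfield M -> vfield M,
    [/\ linear_connection nabla,
        (forall alpha, preserves nabla (Lsub omega L alpha)) /\
          preserves nabla Q,
        forall alpha V X Y x, nabla_form nabla (omega alpha) V X Y x = 0
      & forall X Y, section_of L X -> section_of Q Y ->
          forall x, torsion nabla X Y x = 0].
Proof.
have [_ [distL _] nondeg isoL] := kM; have [distQ _] := intQ.
pose nabla := canonical_connection k_gt0 nondeg distL distQ TM_LQ isoL isoQ psi_eq.
exists nabla; split=> [|N [linN [presS presQ] metricN torsionN]].
  split.
  - exact: canonical_linear_connection.
  - split=> [alpha V X SX|V Y QY].
      by rewrite /nabla (canonical_connectionS _ _ _ _ _ _ _ _ V SX); exact: connS_section.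
    by rewrite /nabla canonical_connectionQ//; exact: connQ_section.
  - exact: canonical_metric.
  - exact: canonical_torsion.
exact: canonical_connection_unique.
Qed.
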